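(* Let $(F,\rho,m)$ be a metric measure space with metric $\rho$ and Radon measure $m$ with full support. Let $\phi,V:[0,\infty)\to[0,\infty)$ be non-decreasing, positive on $(0,\infty)$, with $\phi(0)=V(0)=0$, $\phi$ left-continuous and $\lim_{x\to\infty}\phi(x)=\infty$, and suppose there are constants $c_1,c_2>0$ such that $$c_1V(r)\le m(B(x,r))\le c_2V(r)\qquad\text{for all }x\in F,\ r\ge0,$$ where $B(x,r)=\{y\in F:\rho(x,y)<r\}$. Let $p$ be a symmetric subprobability transition density on $F$, with Dirichlet form $\mathcal E$, and assume that $$p_t(x,y)\approx\frac1{V(\phi^{-1}(t))}\wedge\frac t{V(\rho(x,y))\,\phi(\rho(x,y))},\qquad t>0,\ x,y\in F.$$ If $\underline A>\overline\alpha>0$, $V\in\mathrm{WLSC}(\underline A,\underline C)$ and $\phi\in\mathrm{WUSC}(\overline\alpha,\overline c)$, then there is $C>0$ such that $$\mathcal E(u,u)\ge C\int_F\frac{u(x)^2}{\phi(\rho(x,y))}\,m(dx)\qquad\text{for all }y\in F\text{ and }u\in L^2(F,m).$$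
   Context: Scaling conditions: for $\varphi:[0,\infty)\to[0,\infty)$, $\varphi\in\mathrm{WLSC}(\underline a,\underline k)$ (with $\underline a\in\mathbb R$, $\underline k\in(0,1]$) means $\varphi(\lambda\theta)\ge\underline k\,\lambda^{\underline a}\varphi(\theta)$ for all $\lambda\ge1$, $\theta>0$; $\varphi\in\mathrm{WUSC}(\overline a,\overline k)$ (with $\overline a\in\mathbb R$, $\overline k\in[1,\infty)$) means $\varphi(\lambda\theta)\le\overline k\,\lambda^{\overline a}\varphi(\theta)$ for all $\lambda\ge1$, $\theta>0$. $\phi^{-1}(u)=\inf\{s>0:\phi(s)>u\}$ for $u\ge0$. $a\wedge b=\min(a,b)$, and $t/0=\infty$ for $t>0$. $f\approx g$ means that there is a constant $c>0$ with $c^{-1}g\le f\le cg$ on the whole indicated domain. A symmetric subprobability transition density on $F$ is a jointly measurable function $p:(0,\infty)\times F\times F\to[0,\infty]$ with $p_t(x,y)=p_t(y,x)$, $\int_Fp_s(x,y)p_t(y,z)\,m(dy)=p_{s+t}(x,z)$ for all $x,z\in F$, $s,t>0$, and $\int_Fp_t(x,y)\,m(dy)\le1$; $m$ is $\sigma$-finite. With $p_tu(x)=\int_Fp_t(x,y)u(y)\,m(dy)$, its Dirichlet (quadratic) form is $\mathcal E(u,u)=\lim_{t\to0}\frac1t\int_F(u-p_tu)\,u\,dm\in[0,\infty]$ for $u\in L^2(F,m)$ (the quotient is nonnegative and nonincreasing in $t$). *)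

(* Defs.v *)
From HB Require Import structures.
From mathcomp Require Import all_boot all_order all_algebra.
From mathcomp Require Import all_classical all_reals all_analysis.
From mathcomp Require Import measurable_realfun.
Set Implicit Arguments.
Unset Strict Implicit.
Unset Printing Implicit Defensive.
Import Order.TTheory GRing.Theory Num.Theory.
Import numFieldNormedType.Exports.
Local Open Scope classical_set_scope.
Local Open Scope ring_scope.

(* The library's measurable types are pointed, so a metric space carrying a
   Borel measure has to be pointed as well, i.e., nonempty. *)
#[short(type="pmetricType")]
HB.structure Definition PMetric (R : numDomainType) :=
  {F of Metric R F & Pointed F}.

Definition borel {R : realType} (F : pmetricType R) :=
  g_sigma_algebraType (@open F).

(* Locally finite and inner regular with respect to compact sets on all Borel
   sets; for sigma-finite measures the usual variants agree with this one. *)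
Definition radon {R : realType} (F : pmetricType R)
    (m : {measure set (borel F) -> \bar R}) : Prop :=
  (forall x : F, exists U : set F, [/\ open U, U x & (m U < +oo)%E]) /\
  (forall A : set (borel F), measurable A ->
     m A = ereal_sup [set m K | K in [set K : set F | compact K /\ K `<=` A]]).

Definition full_support {R : realType} (F : pmetricType R)
    (m : {measure set (borel F) -> \bar R}) : Prop :=
  forall U : set F, open U -> U !=set0 -> (0 < m U)%E.

(* Functions [0, +oo) -> [0, +oo) are represented by functions R -> R of which
   only the restriction to [0, +oo) is constrained or used. *)
Definition scale_function {R : realType} (f : R -> R) : Prop :=
  [/\ f 0 = 0,
      forall r, 0 < r -> 0 < f r &
      forall r s, 0 <= r -> r <= s -> f r <= f s].

Definition wlsc {R : realType} (a k : R) (f : R -> R) : Prop :=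
  0 < k <= 1 /\
  forall lam theta, 1 <= lam -> 0 < theta ->
    k * lam `^ a * f theta <= f (lam * theta).

Definition wusc {R : realType} (a k : R) (f : R -> R) : Prop :=
  1 <= k /\
  forall lam theta, 1 <= lam -> 0 < theta ->
    f (lam * theta) <= k * lam `^ a * f theta.

Definition generalized_inverse {R : realType} (phi : R -> R) (u : R) : R :=
  inf [set s | 0 < s /\ u < phi s].

Definition approx_on {R : realType} {T : Type} (D : set T) (f g : T -> \bar R)
    : Prop :=
  exists2 c : R, 0 < c &
    forall z, D z -> ((c^-1)%:E * g z <= f z <= c%:E * g z)%E.

(* Only the values [p t x y] for t > 0 are meaningful. *)
Record transition_density {d} {T : measurableType d} {R : realType}
    (m : {measure set T -> \bar R}) (p : R -> T -> T -> \bar R) : Prop := {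
  td_measurable : measurable_fun
    ([set t : R | 0 < t] `*` [set: T] `*` [set: T] : set (R * T * T))
    ((fun z => p z.1.1 z.1.2 z.2) : R * T * T -> \bar R) ;
  td_ge0 : forall (t : R) x y, 0 < t -> (0 <= p t x y)%E ;
  td_sym : forall (t : R) x y, 0 < t -> p t x y = p t y x ;
  td_chapman_kolmogorov : forall (s t : R) x z, 0 < s -> 0 < t ->
    (\int[m]_y (p s x y * p t y z))%E = p (s + t) x z ;
  td_subprobability : forall (t : R) x, 0 < t ->
    ((\int[m]_y p t x y) <= 1)%E
}.

(* For u in L^2 and a transition density p, the integral converges absolutely
   for almost every x. *)
Definition transition_op {d} {T : measurableType d} {R : realType}
    (m : {measure set T -> \bar R}) (p : R -> T -> T -> \bar R)
    (t : R) (u : T -> R) (x : T) : \bar R :=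
  (\int[m]_y (p t x y * (u y)%:E))%E.

(* For u in L^2, the quotient is nonnegative and nonincreasing in t, so that the
   limit exists in [0, +oo]; [lim] is a junk value when there is no limit. *)
Definition dirichlet_form {d} {T : measurableType d} {R : realType}
    (m : {measure set T -> \bar R}) (p : R -> T -> T -> \bar R)
    (u : T -> R) : \bar R :=
  lim (((t^-1)%:E *
        (\int[m]_x (((u x)%:E - transition_op m p t u x) * (u x)%:E)))%E
       @[t --> (0 : R)^'+]).

(* In [\bar R], 0^-1 = +oo. *)
Definition heat_kernel_estimate {R : realType} (phi V : R -> R) (t r : R)
    : \bar R :=
  mine ((V (generalized_inverse phi t))%:E^-1)%E (t%:E / (V r * phi r)%:E)%E.

(* Main.v *)
Require Import Defs.
From HB Require Import structures.
From mathcomp Require Import all_boot all_order all_algebra.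
From mathcomp Require Import all_classical all_reals all_analysis.
From mathcomp Require Import measurable_realfun lra ring.
Set Implicit Arguments.
Unset Strict Implicit.
Import Order.TTheory GRing.Theory Num.Theory.
Import numFieldNormedType.Exports.
Local Open Scope classical_set_scope.
Local Open Scope ring_scope.

(* Fix a pole y and a time t > 0, put e = (A/alpha - 1)/2 and
     h(x) = sum_(k >= 1) k^e p_(k t)(x, y),
   a discrete substitute for the integral of s^e p_s(x, y) ds.  By
   Chapman-Kolmogorov, h - p_t h = D with
     D(x) = sum_(k >= 1) (k^e - (k-1)^e) p_(k t)(x, y) >= 0.
   The ground state inequality
     2 |u(x) u(z)| <= u(x)^2 h(z)/h(x) + u(z)^2 h(x)/h(z)
   integrated against p_t(x, z) gives <u - p_t u, u> >= int u^2 D/h dm.  The heat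
   kernel estimate, cut at the number K of steps with K t < phi(r) <= (K+1) t,
   r = rho(x, y), yields h <~ K^(1+e)/V(r) (the tail is summable because
   V(phi^-1(s)) grows at least like s^(1+2e)) and D >~ K^e/V(r), hence
   D/h >~ t/phi(r) as soon as phi(r) > t.

   The difference quotient converges as t -> 0 because <p_t u, u> is bounded
   and midpoint convex in t: <p_2s u, u> + <p_2t u, u> - 2 <p_(s+t) u, u> is
   the square of the norm of p_s u - p_t u. *)

(** * Symmetric transition densities *)

(** Taking the step of the discrete potential equal to the time of the difference quotient makes h -
    p_t h = D an exact shift of index, with no integration in time. The price is a lower bound for
    D/h only where phi(r) > t. Each quotient thus controls the weighted integral over the set where
    phi(rho) > t alone, but with a constant independent of t; the quotients lie below the form, and
    these sets exhaust the complement of the pole as t decreases. The pole is the obstacle at a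
    fixed t: h may be infinite there, and the weight u^2/h degenerates. Its measure vanishes by the
    scaling of V. Everything is carried out with nonnegative extended functions, u being split into
    its positive and negative parts, so that Tonelli's theorem applies before any finiteness is
    known; differences are formed only once the bound by the norm of u has made the terms finite. *)

Definition heat {d} {T : measurableType d} {R : realType}
    (m : set T -> \bar R) (p : R -> T -> T -> \bar R)
    (t : R) (f : T -> \bar R) (x : T) : \bar R :=
  (\int[m]_y (p t x y * f y))%E.

Section semigroup.
Context d (T : measurableType d) (R : realType).
Variables (m : {sigma_finite_measure set T -> \bar R}).
Variables (p : R -> T -> T -> \bar R).
Hypothesis p_td : transition_density m p.
Local Notation heat := (heat m p).
Local Open Scope ereal_scope.

Lemma measurable_density (t : R) : (0 < t)%R ->
  measurable_fun [set: T * T] (fun z => p t z.1 z.2).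
Proof.
move=> t0.
have mD : measurable ([set t : R | 0 < t]%R `*` [set: T] `*` [set: T]
    : set (R * T * T)).
  apply: measurableX => //; apply: measurableX => //.
  rewrite (_ : [set t : R | (0 < t)%R] = `]0%R, +oo[%classic)//.
  by apply/seteqP; split => r /=; rewrite in_itv/= andbT.
have mz : measurable_fun [set: T * T] (fun z : T * T => ((t, z.1), z.2)).
  by apply: measurable_fun_pair => //; exact: measurable_fun_pair.
apply: (measurable_comp mD _ (td_measurable p_td) mz).
by move=> _ [z _ <-].
Qed.

Lemma measurable_density2 (t : R) (x : T) : (0 < t)%R ->
  measurable_fun [set: T] (p t x).
Proof.
move=> t0.
have mp : measurable_fun [set: T] (pair x : T -> T * T).
  exact: pair1_measurable.
rewrite (_ : p t x = (fun z => p t z.1 z.2) \o pair x)//.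
by apply: measurableT_comp mp; exact: measurable_density.
Qed.

Section nonneg.
Variables (f : T -> \bar R).
Hypotheses (mf : measurable_fun [set: T] f) (f0 : forall x, 0 <= f x).

Lemma heat_ge0 (t : R) x : (0 < t)%R -> 0 <= heat t f x.
Proof.
by move=> t0; apply: integral_ge0 => y _; rewrite mule_ge0 ?(td_ge0 p_td).
Qed.

Lemma measurable_density_mul (t : R) : (0 < t)%R ->
  measurable_fun [set: T * T] (fun z => p t z.1 z.2 * f z.2).
Proof.
move=> t0; apply: emeasurable_funM; first exact: measurable_density.
exact: measurableT_comp.
Qed.

Lemma measurable_heat (t : R) : (0 < t)%R ->
  measurable_fun [set: T] (heat t f).
Proof.
move=> t0; apply: (@measurable_fun_fubini_tonelli_F _ _ _ _ _ m
  (fun z : T * T => p t z.1 z.2 * f z.2)).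
  exact: measurable_density_mul.
by move=> z; rewrite mule_ge0 ?(td_ge0 p_td).
Qed.

End nonneg.

Lemma heat_sym (t : R) f g : (0 < t)%R ->
  measurable_fun [set: T] f -> (forall x, 0 <= f x) ->
  measurable_fun [set: T] g -> (forall x, 0 <= g x) ->
  \int[m]_x (heat t f x * g x) = \int[m]_x (f x * heat t g x).
Proof.
move=> t0 mf f0 mg g0.
have p0 x y : 0 <= p t x y by exact: (td_ge0 p_td).
transitivity (\int[m]_x \int[m]_y (p t x y * f y * g x)).
  apply: eq_integral => x _; rewrite ge0_integralZr//.
    by apply: emeasurable_funM => //; exact: measurable_density2.
  by move=> y _; rewrite mule_ge0.
rewrite (@fubini_tonelli _ _ _ _ _ m m
  (fun z => p t z.1 z.2 * f z.2 * g z.1))/=.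
- apply: eq_integral => y _; rewrite -ge0_integralZl//.
  + by apply: eq_integral => x _; rewrite (td_sym p_td)// muleAC muleC muleCA.
  + by apply: emeasurable_funM => //; exact: measurable_density2.
  + by move=> x _; rewrite mule_ge0.
- apply: emeasurable_funM; first exact: measurable_density_mul.
  exact: measurableT_comp.
- by move=> z; rewrite !mule_ge0.
Qed.

Lemma heatD (s t : R) f x : (0 < s)%R -> (0 < t)%R ->
  measurable_fun [set: T] f -> (forall x, 0 <= f x) ->
  heat s (heat t f) x = heat (s + t) f x.
Proof.
move=> s0 t0 mf f0.
have ps y z : 0 <= p s y z by exact: (td_ge0 p_td).
have pt y z : 0 <= p t y z by exact: (td_ge0 p_td).
transitivity (\int[m]_y \int[m]_z (p s x y * (p t y z * f z))).
  apply: eq_integral => y _; rewrite ge0_integralZl//.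
    by apply: emeasurable_funM => //; exact: measurable_density2.
  by move=> z _; rewrite mule_ge0.
rewrite (@fubini_tonelli _ _ _ _ _ m m
  (fun z => p s x z.1 * (p t z.1 z.2 * f z.2)))/=.
- apply: eq_integral => z _.
  rewrite -(td_chapman_kolmogorov p_td)// -ge0_integralZr//.
  + by apply: eq_integral => y _; rewrite muleA.
  + apply: emeasurable_funM; first exact: measurable_density2.
    rewrite (_ : (fun y => p t y z) = p t z); first exact: measurable_density2.
    by apply/funext => y; rewrite (td_sym p_td).
  + by move=> y _; rewrite mule_ge0.
- apply: emeasurable_funM; last exact: measurable_density_mul.
  by apply: measurableT_comp => //; exact: measurable_density2.
- by move=> z; rewrite !mule_ge0.
Qed.

Lemma heat_le (t : R) f g x : (0 < t)%R ->
  measurable_fun [set: T] f -> (forall x, 0 <= f x) ->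
  measurable_fun [set: T] g -> (forall x, f x <= g x) ->
  heat t f x <= heat t g x.
Proof.
move=> t0 mf f0 mg fg.
have pt y z : 0 <= p t y z by exact: (td_ge0 p_td).
apply: ge0_le_integral => //.
- by move=> y _; rewrite mule_ge0.
- by apply: emeasurable_funM => //; exact: measurable_density2.
- by apply: emeasurable_funM => //; exact: measurable_density2.
- by move=> y _; rewrite lee_wpmul2l.
Qed.

Lemma heat_add (t : R) f g x : (0 < t)%R ->
  measurable_fun [set: T] f -> (forall x, 0 <= f x) ->
  measurable_fun [set: T] g -> (forall x, 0 <= g x) ->
  heat t (f \+ g) x = heat t f x + heat t g x.
Proof.
move=> t0 mf f0 mg g0.
have pt y z : 0 <= p t y z by exact: (td_ge0 p_td).
rewrite -ge0_integralD//.
- by apply: eq_integral => y _; rewrite ge0_muleDr.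
- by move=> y _; rewrite mule_ge0.
- by apply: emeasurable_funM => //; exact: measurable_density2.
- by move=> y _; rewrite mule_ge0.
- by apply: emeasurable_funM => //; exact: measurable_density2.
Qed.

Lemma heat_scale (t : R) c f x : (0 < t)%R -> 0 <= c ->
  measurable_fun [set: T] f -> (forall x, 0 <= f x) ->
  heat t (fun y => c * f y) x = c * heat t f x.
Proof.
move=> t0 c0 mf f0.
have pt y z : 0 <= p t y z by exact: (td_ge0 p_td).
rewrite -ge0_integralZl//.
- by apply: eq_integral => y _; rewrite muleCA.
- by apply: emeasurable_funM => //; exact: measurable_density2.
- by move=> y _; rewrite mule_ge0.
Qed.

(* With k = f^2 / h the hypothesis on f, k and h is the arithmetic-geometric
   mean inequality, and the bound is that of the form by its ground state. *)
Lemma schur_test (t : R) f k h : (0 < t)%R ->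
  measurable_fun [set: T] f -> (forall x, 0 <= f x) ->
  measurable_fun [set: T] k -> (forall x, 0 <= k x) ->
  measurable_fun [set: T] h -> (forall x, 0 <= h x) ->
  (forall x z, 2%:E * (f x * f z) <= k x * h z + k z * h x) ->
  \int[m]_x (heat t f x * f x) <= \int[m]_x (k x * heat t h x).
Proof.
move=> t0 mf f0 mk k0 mh h0 fkh.
have Hf0 g x (g0 : forall x, 0 <= g x) : 0 <= heat t g x by exact: heat_ge0.
have mH g (mg : measurable_fun [set: T] g) (g0 : forall x, 0 <= g x) :
  measurable_fun [set: T] (heat t g) by exact: measurable_heat.
rewrite -(@lee_pmul2l _ 2%:E)//.
(* By symmetry <k, p_t h> = <h, p_t k>, so the right-hand side takes the symmetric shape of the
   hypothesis and the two sides can be compared under the kernel integral. *)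
have -> : 2%:E * \int[m]_x (k x * heat t h x) =
    \int[m]_x (k x * heat t h x + h x * heat t k x).
  rewrite ge0_integralD//.
  - rewrite mule_natl mule2n; congr (_ + _).
    by rewrite -heat_sym//; apply: eq_integral => x _; rewrite muleC.
  - by move=> x _; rewrite mule_ge0 ?Hf0.
  - by apply: emeasurable_funM => //; exact: mH.
  - by move=> x _; rewrite mule_ge0 ?Hf0.
  - by apply: emeasurable_funM => //; exact: mH.
rewrite -ge0_integralZl//; first last.
- by move=> x _; rewrite mule_ge0 ?Hf0.
- by apply: emeasurable_funM => //; exact: mH.
apply: ge0_le_integral => //.
- by move=> x _; rewrite !mule_ge0 ?Hf0.
- by apply: emeasurable_funM => //; apply: emeasurable_funM => //; exact: mH.
- by apply: emeasurable_funD; apply: emeasurable_funM => //; exact: mH.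
move=> x _.
rewrite -!heat_scale// -heat_add//; first last.
- by move=> y; rewrite mule_ge0.
- exact: emeasurable_funM.
- by move=> y; rewrite mule_ge0.
- exact: emeasurable_funM.
rewrite [X in 2%:E * X]muleC -heat_scale// -heat_scale//; first last.
- by move=> y; rewrite mule_ge0.
- exact: emeasurable_funM.
apply: heat_le => //.
- by apply: emeasurable_funM => //; exact: emeasurable_funM.
- by move=> y; rewrite !mule_ge0.
- by apply: emeasurable_funD; exact: emeasurable_funM.
- by move=> y /=; rewrite [h x * _]muleC; exact: fkh.
Qed.

(** The Schur test with weight 1 and [k] = f^2; p_t 1 <= 1 then removes the operator. No
    integrability is assumed. *)
Lemma heat_sq_le (t : R) f : (0 < t)%R ->
  measurable_fun [set: T] f -> (forall x, 0 <= f x) ->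
  \int[m]_x (heat t f x * f x) <= \int[m]_x (f x * f x).
Proof.
move=> t0 mf f0.
apply: (@le_trans _ _ (\int[m]_x ((f x * f x) * heat t (cst 1) x))).
  apply: schur_test => //.
  - exact: emeasurable_funM.
  - by move=> x; rewrite mule_ge0.
  - move=> x z /=; rewrite !mule1.
    move: (f0 x) (f0 z); case: (f x) => [a| |]; case: (f z) => [b| |] //=.
    + rewrite -!EFinM -EFinD !lee_fin => a0 b0.
      by have := sqr_ge0 (a - b); rewrite sqrrB; nra.
    + by move=> _ _; rewrite mulyy addey// leey.
    + by move=> _ _; rewrite mulyy addye// leey.
    + by move=> _ _; rewrite !mulyy leey.
apply: ge0_le_integral => //.
- by move=> x _; rewrite !mule_ge0 ?heat_ge0.
- apply: emeasurable_funM; first exact: emeasurable_funM.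
  exact: measurable_heat.
- exact: emeasurable_funM.
- move=> x _; rewrite -[leRHS]mule1 lee_wpmul2l ?mule_ge0//.
  rewrite /heat; under eq_integral do rewrite mule1.
  exact: (td_subprobability p_td).
Qed.

End semigroup.

(** * Bounded midpoint convex functions *)

(** The Archimedean property lets errors of order 1/n replace a limit, so that continuity in time
    need not be proved. *)
Lemma ler_all_inv {R : realType} (x c : R) :
  (forall n : nat, x <= c / n.+1%:R) -> x <= 0.
Proof.
move=> xc; rewrite leNgt; apply/negP => x0.
have := xc (Num.truncn (c / x)); rewrite ler_pdivlMr ?ltr0n// leNgt => /negP; apply.
by rewrite mulrC -ltr_pdivrMr// truncnS_gt.
Qed.

(** Increments of a convex sequence increase, so a single positive one would force linear growth
    past [M]. *)
Lemma bounded_convex_seq_nonincreasing {R : realType} (b : nat -> R) (M : R) :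
  (forall k, 2 * b k.+1 <= b k + b k.+2) -> (forall k, b k <= M) ->
  forall k, b k.+1 <= b k.
Proof.
move=> bconv bM k; rewrite -subr_le0.
have incr n : b k.+1 - b k <= b (k + n).+1 - b (k + n)%N.
  elim: n => [|n IH]; first by rewrite addn0.
  by apply: (le_trans IH); rewrite addnS; have := bconv (k + n)%N; lra.
have lin n : n%:R * (b k.+1 - b k) <= b (k + n)%N - b k.
  elim: n => [|n IH]; first by rewrite mul0r addn0 subrr.
  rewrite -natr1 mulrDl mul1r addnS.
  by have := incr n; move: IH; set y := _ * _; lra.
apply: (@ler_all_inv _ _ (M - b k)) => n; rewrite ler_pdivlMr// mulrC.
by apply: le_trans (lin n.+1) _; rewrite lerB.
Qed.

(** The chord slopes (b 0 - b n)/n decrease with n; multiplied out, the inequality also covers [m] =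
    0. It rests on [step]: each drop is at most the average of the drops before it. *)
Lemma convex_seq_slope {R : realType} (b : nat -> R) :
  (forall k, 2 * b k.+1 <= b k + b k.+2) ->
  forall m n, (m <= n)%N -> m%:R * (b 0%N - b n) <= n%:R * (b 0%N - b m).
Proof.
move=> bconv.
have step k : k%:R * (b k - b k.+1) <= b 0%N - b k.
  elim: k => [|k IH]; first by rewrite mul0r subrr.
  rewrite -natr1 mulrDl mul1r.
  have := bconv k => c; apply: (@le_trans _ _ (k%:R * (b k - b k.+1) + (b k - b k.+1))).
    by apply: lerD; [apply: ler_wpM2l => //|]; lra.
  by move: IH; set y := _ * _; lra.
move=> m; elim=> [|n IH]; first by rewrite leqn0 => /eqP ->.
rewrite leq_eqVlt => /predU1P[->//|]; rewrite ltnS => mn.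
have [->|m0] := eqVneq m 0%N; first by rewrite mul0r subrr mulr0.
have n0 : (0 < n%:R :> R) by rewrite ltr0n (leq_trans _ mn)// lt0n.
rewrite -(ler_pM2l n0).
have -> : n%:R * (m%:R * (b 0%N - b n.+1)) = m%:R * (n%:R * (b 0%N - b n.+1)).
  by rewrite mulrCA.
have st : n%:R * (b 0%N - b n.+1) <= n.+1%:R * (b 0%N - b n).
  by have := step n; rewrite -[n.+1%:R]natr1 !mulrDl !mul1r !mulrDr !mulrN; lra.
apply: (@le_trans _ _ (m%:R * (n.+1%:R * (b 0%N - b n)))).
  exact: ler_wpM2l.
by rewrite mulrCA [leRHS]mulrCA ler_wpM2l// IH.
Qed.

(** Midpoint convexity alone compares slopes only at commensurable times. The upper bound makes [g]
    nonincreasing, and monotonicity takes the place of continuity in passing to all s <= t. *)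
Lemma bounded_midpoint_convex_slope {R : realType} (g : R -> R) (M : R) :
  (forall s t, 0 <= s -> 0 <= t -> 2 * g (s + t) <= g (s + s) + g (t + t)) ->
  (forall t, 0 <= t -> g t <= M) ->
  forall s t, 0 < s -> s <= t -> (g 0 - g t) / t <= (g 0 - g s) / s.
Proof.
move=> gconv gM.
have conv s tau : 0 <= s -> 0 <= tau -> forall k : nat,
    2 * g (s + k.+1%:R * tau) <= g (s + k%:R * tau) + g (s + k.+2%:R * tau).
  move=> s0 tau0 k.
  have k0 : 0 <= k%:R :> R by [].
  have := @gconv ((s + k%:R * tau) / 2) ((s + k.+2%:R * tau) / 2).
  rewrite -[k.+2%:R]natr1 -[k.+1%:R]natr1.
  have -> : (s + k%:R * tau) / 2 + (s + (k%:R + 1 + 1) * tau) / 2 =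
      s + (k%:R + 1) * tau by lra.
  rewrite -!splitr; apply; nra.
have ni s t : 0 <= s -> s <= t -> g t <= g s.
  move=> s0 st; have st0 : 0 <= t - s by rewrite subr_ge0.
  have := @bounded_convex_seq_nonincreasing _ (fun k => g (s + k%:R * (t - s)))
    M (conv _ _ s0 st0) _ 0%N.
  rewrite mul0r addr0 mul1r (addrC s) subrK; apply.
  by move=> k; apply: gM; rewrite addr_ge0// mulr_ge0.
move=> s t s0 st; have t0 : 0 < t by exact: lt_le_trans st.
rewrite ler_pdivrMr// mulrAC ler_pdivlMr//.
rewrite -subr_le0; apply: (@ler_all_inv _ _ (t * (g 0 - g t))) => n.
have N0 : 0 < n.+1%:R :> R by [].
(* m t/(n+1) is the last grid point not exceeding s. Replacing [g] there by g s goes in the right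
   direction by monotonicity, and rounding costs at most t (g 0 - g t)/(n+1). *)
pose m := Num.truncn (n.+1%:R * s / t).
have st0 : 0 <= n.+1%:R * s / t.
  by rewrite divr_ge0// ?mulr_ge0// ltW.
have /andP[m1 m2] := truncn_itv st0.
have mn : (m <= n.+1)%N.
  rewrite -(@ler_nat R) (le_trans m1)// ler_pdivrMr// ler_wpM2l//.
have := @convex_seq_slope _ (fun k => g (0 + k%:R * (t / n.+1%:R)))
  (conv _ _ (lexx _) (divr_ge0 (ltW t0) (ltW N0))) _ _ mn.
rewrite mul0r addr0 !add0r.
have -> : n.+1%:R * (t / n.+1%:R) = t by rewrite mulrC divfK ?gt_eqF.
have ms : m%:R * (t / n.+1%:R) <= s.
  by rewrite mulrA ler_pdivrMr// -ler_pdivlMr// (mulrC s).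
have g0t : 0 <= g 0 - g t by rewrite subr_ge0 ni// ltW.
have m0 : 0 <= m%:R * (t / n.+1%:R) by rewrite mulr_ge0// divr_ge0// ltW.
have := ni _ _ m0 ms; set gm := g (m%:R * _) => gsm slope.
rewrite ler_pdivlMr//.
have {}m2 : n.+1%:R * s <= (m%:R + 1) * t by rewrite natr1 -ler_pdivrMr// ltW.
have h1 : m%:R * (g 0 - g t) * t <= n.+1%:R * (g 0 - gm) * t by rewrite ler_wpM2r// ltW.
have h2 : n.+1%:R * s * (g 0 - g t) <= (m%:R + 1) * t * (g 0 - g t).
  by rewrite ler_wpM2r.
have h3 : n.+1%:R * t * (g 0 - gm) <= n.+1%:R * t * (g 0 - g s).
  by rewrite ler_wpM2l ?mulr_ge0 ?(ltW t0)// lerD2l lerN2.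
move: h1 h2 h3; set N := n.+1%:R; lra.
Qed.

(** * The approximating forms and their limit *)

Section integral_mul.
Context d (T : measurableType d) (R : realType).
Variables (m : {measure set T -> \bar R}).
Local Open Scope ereal_scope.
Local Notation J a b := (\int[m]_x (a x * b x)).

Lemma integral_mulC (a b : T -> \bar R) : J a b = J b a.
Proof. by apply: eq_integral => x _; rewrite muleC. Qed.

Lemma integral_mulDl (a b c : T -> \bar R) :
  measurable_fun [set: T] a -> (forall x, 0 <= a x) ->
  measurable_fun [set: T] b -> (forall x, 0 <= b x) ->
  measurable_fun [set: T] c -> (forall x, 0 <= c x) ->
  J (a \+ b) c = J a c + J b c.
Proof.
move=> ma a0 mb b0 mc c0; rewrite -ge0_integralD//.
- by apply: eq_integral => x _; rewrite ge0_muleDl.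
- by move=> x _; rewrite mule_ge0.
- exact: emeasurable_funM.
- by move=> x _; rewrite mule_ge0.
- exact: emeasurable_funM.
Qed.

Lemma integral_mulDr (a b c : T -> \bar R) :
  measurable_fun [set: T] a -> (forall x, 0 <= a x) ->
  measurable_fun [set: T] b -> (forall x, 0 <= b x) ->
  measurable_fun [set: T] c -> (forall x, 0 <= c x) ->
  J c (a \+ b) = J c a + J c b.
Proof.
by move=> *; rewrite integral_mulC integral_mulDl// !(integral_mulC c).
Qed.

Lemma integral_mul_AGM (a b : T -> \bar R) :
  measurable_fun [set: T] a -> (forall x, 0 <= a x) ->
  measurable_fun [set: T] b -> (forall x, 0 <= b x) ->
  J a b + J a b <= J a a + J b b.
Proof.
move=> ma a0 mb b0.
have M (f g : T -> \bar R) : measurable_fun [set: T] f ->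
  measurable_fun [set: T] g -> measurable_fun [set: T] (fun x => f x * g x).
  by move=> mf mg; exact: emeasurable_funM.
have P (f g : T -> \bar R) : (forall x, 0 <= f x) -> (forall x, 0 <= g x) ->
  forall x, [set: T] x -> 0 <= f x * g x.
  by move=> f0 g0 x _; rewrite mule_ge0.
rewrite -ge0_integralD//; [|exact: P|exact: M|exact: P|exact: M].
rewrite -ge0_integralD//; [|exact: P|exact: M|exact: P|exact: M].
apply: ge0_le_integral => //.
- by move=> x _; rewrite adde_ge0 ?mule_ge0.
- by apply: emeasurable_funD; exact: M.
- by apply: emeasurable_funD; exact: M.
move=> x _; move: (a0 x) (b0 x).
case: (a x) => [r| |]; case: (b x) => [s| |] //=.
+ rewrite -!EFinM -!EFinD !lee_fin => r0 s0.
  by have := sqr_ge0 (r - s); rewrite sqrrB; nra.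
all: by move=> *; rewrite ?mulyy ?addey ?addye ?leey.
Qed.

(* [integral_mul_AGM] for a + e and b + c, expanded: it is the midpoint
   convexity of <p_t u, u> when a, b and c, e are the images of the positive and
   negative parts of u under p_s and p_t. *)
Lemma integral_mul_AGM4 (a b c e : T -> \bar R)
    (ab ac be ce aa ae bb cb cc ee : R) :
  measurable_fun [set: T] a -> (forall x, 0 <= a x) ->
  measurable_fun [set: T] b -> (forall x, 0 <= b x) ->
  measurable_fun [set: T] c -> (forall x, 0 <= c x) ->
  measurable_fun [set: T] e -> (forall x, 0 <= e x) ->
  J a b = ab%:E -> J a c = ac%:E -> J b e = be%:E -> J c e = ce%:E ->
  J a a = aa%:E -> J a e = ae%:E -> J b b = bb%:E -> J c b = cb%:E ->
  J c c = cc%:E -> J e e = ee%:E ->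
  (2 * (ab + ac + be + ce) <= aa + ee + bb + cc + 2 * (ae + cb))%R.
Proof.
move=> ma a0 mb b0 mc c0 me e0 Eab Eac Ebe Ece Eaa Eae Ebb Ecb Ecc Eee.
have mae : measurable_fun [set: T] (a \+ e) by exact: emeasurable_funD.
have mbc : measurable_fun [set: T] (b \+ c) by exact: emeasurable_funD.
have ae0 x : 0 <= (a \+ e) x by rewrite adde_ge0.
have bc0 x : 0 <= (b \+ c) x by rewrite adde_ge0.
have := integral_mul_AGM mae ae0 mbc bc0.
rewrite (integral_mulDl ma a0 me e0 mbc bc0).
rewrite (integral_mulDl ma a0 me e0 mae ae0).
rewrite (integral_mulDl mb b0 mc c0 mbc bc0).
rewrite (integral_mulDr ma a0 me e0 ma a0) (integral_mulDr ma a0 me e0 me e0).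
rewrite (integral_mulDr mb b0 mc c0 ma a0) (integral_mulDr mb b0 mc c0 me e0).
rewrite (integral_mulDr mb b0 mc c0 mb b0) (integral_mulDr mb b0 mc c0 mc c0).
rewrite (integral_mulC e a) (integral_mulC e b) (integral_mulC e c).
rewrite (integral_mulC b c) Eab Eac Ebe Ece Eaa Eae Ebb Ecb Ecc Eee.
rewrite -!EFinD lee_fin; lra.
Qed.

End integral_mul.

(** Here x, y, z stand for <p_t f, f>, <p_t f, h>, <p_t h, h> with f, h the positive and negative
    parts of u; the sum is <p_t |u|, |u|>. *)
Lemma fin_num_parts {R : realType} (x y z : \bar R) :
  (0 <= x -> 0 <= y -> 0 <= z -> x + y + (y + z) < +oo ->
  [/\ x \is a fin_num, y \is a fin_num & z \is a fin_num])%E.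
Proof. by case: x => [x| |]; case: y => [y| |]; case: z => [z| |]. Qed.

Lemma fine_parts_le {R : realType} (x y z : \bar R) :
  (x \is a fin_num -> y \is a fin_num -> z \is a fin_num -> 0 <= y ->
  (fine x + fine z - 2 * fine y)%:E <= x + y + (y + z))%E.
Proof.
case: x => [x| |]//; case: y => [y| |]//; case: z => [z| |]// _ _ _.
rewrite -!EFinD !lee_fin/=; lra.
Qed.

Lemma energy_form_midpoint_aux {R : realType}
    (ab ac be ce aa ae bb cc ee : R) :
  2 * (ab + ac + be + ce) <= aa + ee + bb + cc + 2 * (ae + ae) ->
  2 * (ac + be - 2 * ae) <= aa + bb - 2 * ab + (cc + ee - 2 * ce).
Proof. lra. Qed.

(* The finiteness hypothesis excludes a = b = +oo, where a - b is -oo. *)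
Lemma sub_mul_posneg {R : realType} (a b : \bar R) (v : R) :
  (0 <= a -> 0 <= b ->
  let f := maxe v%:E 0 in let h := maxe (- v%:E) 0 in
  a * f + b * h \is a fin_num ->
  (v%:E - (a - b)) * v%:E = (v ^+ 2)%:E + (a * h + b * f) - (a * f + b * h))%E.
Proof.
move=> a0 b0 /=; rewrite -!EFin_max.
have [v0|v0|->] := ltgtP v 0.
- rewrite (@max_l _ _ (- v)) ?oppr_ge0 ?(ltW v0)//.
  case: b b0 => [b| |]// b0; last first.
    by rewrite mule0 add0e gt0_mulye// lte_fin oppr_gt0.
  case: a a0 => [a| |]// a0 _.
    by rewrite -!(EFinD, EFinM, EFinN); congr EFin; ring.
  rewrite !mule0 add0e adde0 gt0_mulye ?lte_fin ?oppr_gt0//.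
  have -> : (v%:E - (+oo - b%:E) = -oo)%E by [].
  by rewrite lt0_mulNye// lte_fin.
- rewrite (@max_r _ _ (- v)) ?oppr_le0 ?(ltW v0)//.
  case: a a0 => [a| |]// a0; last first.
    by rewrite mule0 adde0 gt0_mulye// lte_fin.
  case: b b0 => [b| |]// b0 _.
    by rewrite -!(EFinD, EFinM, EFinN); congr EFin; ring.
  have -> : (v%:E - (a%:E - +oo) = +oo)%E by [].
  have -> : (+oo * v%:E = +oo)%E by rewrite gt0_mulye// lte_fin.
  by rewrite !mule0 add0e adde0.
- by move=> _; rewrite oppr0 ?maxxx !mule0 expr0n/= !adde0 addr0 oppr0 adde0.
Qed.

Lemma fine_parts_sub {R : realType} (r : R) (x y z : \bar R) :
  (x \is a fin_num -> y \is a fin_num -> z \is a fin_num ->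
  r%:E + (y + y) - (x + z) = (r - (fine x + fine z - 2 * fine y))%:E)%E.
Proof.
case: x => [x| |]//; case: y => [y| |]//; case: z => [z| |]// _ _ _ /=.
by rewrite -!EFinD; congr EFin; ring.
Qed.

Section energy.
Context d (T : measurableType d) (R : realType).
Variables (m : {sigma_finite_measure set T -> \bar R}).
Variables (p : R -> T -> T -> \bar R).
Hypothesis p_td : transition_density m p.
Variable u : T -> R.
Hypothesis u2 : m.-integrable [set: T] (fun x => (u x ^+ 2)%:E).
Hypothesis mu : measurable_fun [set: T] u.
Local Open Scope ereal_scope.
Local Notation J a b := (\int[m]_x (a x * b x)).

(* p_0 is the identity; the given density is meaningless at t = 0. *)
Definition heat0 (t : R) (f : T -> \bar R) : T -> \bar R :=
  if t == 0%R then f else heat m p t f.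

Lemma heat0_ge0 (t : R) f : (0 <= t)%R -> (forall x, 0 <= f x) ->
  forall x, 0 <= heat0 t f x.
Proof.
rewrite /heat0; case: eqP => // /eqP t0 t1 f0 x.
by apply: heat_ge0 => //; rewrite lt_neqAle eq_sym t0.
Qed.

Lemma measurable_heat0 (t : R) f : (0 <= t)%R ->
  measurable_fun [set: T] f -> (forall x, 0 <= f x) ->
  measurable_fun [set: T] (heat0 t f).
Proof.
rewrite /heat0; case: eqP => // /eqP t0 t1 mf f0.
by apply: measurable_heat => //; rewrite lt_neqAle eq_sym t0.
Qed.

Lemma heat0_sym (t : R) f g : (0 <= t)%R ->
  measurable_fun [set: T] f -> (forall x, 0 <= f x) ->
  measurable_fun [set: T] g -> (forall x, 0 <= g x) ->
  J (heat0 t f) g = J f (heat0 t g).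
Proof.
rewrite /heat0; case: eqP => // /eqP t0 t1 mf f0 mg g0.
by apply: heat_sym => //; rewrite lt_neqAle eq_sym t0.
Qed.

Lemma heat0D (s t : R) f x : (0 <= s)%R -> (0 <= t)%R ->
  measurable_fun [set: T] f -> (forall x, 0 <= f x) ->
  heat0 s (heat0 t f) x = heat0 (s + t) f x.
Proof.
move=> s0 t0 mf f0; rewrite /heat0.
have [->|s1] := eqVneq s 0%R; first by rewrite add0r.
have [->|t1] := eqVneq t 0%R; first by rewrite addr0 (negbTE s1).
rewrite paddr_eq0// (negbTE s1)/= heatD//; by rewrite lt_neqAle eq_sym ?s1 ?t1.
Qed.

Lemma heat0_mul (s t : R) f g : (0 <= s)%R -> (0 <= t)%R ->
  measurable_fun [set: T] f -> (forall x, 0 <= f x) ->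
  measurable_fun [set: T] g -> (forall x, 0 <= g x) ->
  J (heat0 s f) (heat0 t g) = J (heat0 (s + t) f) g.
Proof.
move=> s0 t0 mf f0 mg g0.
rewrite -(heat0_sym t0 (measurable_heat0 s0 mf f0) (heat0_ge0 s0 f0) mg g0).
by apply: eq_integral => x _; rewrite (heat0D x t0 s0 mf f0) (addrC t s).
Qed.

Lemma heat0_add (t : R) f g : (0 <= t)%R ->
  measurable_fun [set: T] f -> (forall x, 0 <= f x) ->
  measurable_fun [set: T] g -> (forall x, 0 <= g x) ->
  heat0 t (f \+ g) = heat0 t f \+ heat0 t g.
Proof.
rewrite /heat0; case: eqP => // /eqP t0 t1 mf f0 mg g0.
by apply/funext => x; rewrite heat_add// lt_neqAle eq_sym t0.
Qed.

Let f := (EFin \o u)^\+.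
Let h := (EFin \o u)^\-.

Let mf : measurable_fun [set: T] f.
Proof. by apply: measurable_funepos; exact/measurable_EFinP. Qed.
Let mh : measurable_fun [set: T] h.
Proof. by apply: measurable_funeneg; exact/measurable_EFinP. Qed.
Let f0 x : 0 <= f x. Proof. exact: funepos_ge0. Qed.
Let h0 x : 0 <= h x. Proof. exact: funeneg_ge0. Qed.

Let fhE : f \+ h = (fun x => `|u x|%:E).
Proof.
apply/funext => x; rewrite /f /h !funeposE !funenegE/= -!EFin_max -EFinD.
congr EFin; case: (leP 0%R (u x)) => ux.
  by rewrite (ger0_norm ux) (@max_r _ _ (- u x)%R) ?addr0 ?oppr_le0.
rewrite (ltr0_norm ux).
by rewrite (@max_l _ _ (- u x)%R) ?add0r// oppr_ge0 ltW.
Qed.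

Let fhx x : f x + h x = `|u x|%:E.
Proof. exact: (congr1 (fun q => q x) fhE). Qed.

Let absabs : J (f \+ h) (f \+ h) = \int[m]_x (u x ^+ 2)%:E.
Proof.
by apply: eq_integral => x _; rewrite /= fhx -EFinM -expr2 real_normK ?num_real.
Qed.

Let expand (t : R) : (0 <= t)%R -> J (heat0 t (f \+ h)) (f \+ h) =
  J (heat0 t f) f + J (heat0 t f) h + (J (heat0 t f) h + J (heat0 t h) h).
Proof.
move=> t0; rewrite heat0_add// integral_mulDl ?integral_mulDr//.
- rewrite [X in _ + (X + _)]heat0_sym//; congr (_ + (_ + _)).
  exact: integral_mulC.
all: try exact: measurable_heat0; try exact: heat0_ge0; try exact: emeasurable_funD.
by move=> x; rewrite adde_ge0.
Qed.

Let u2_fin : \int[m]_x (u x ^+ 2)%:E < +oo.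
Proof.
move/integrableP : u2 => [_]; under eq_integral => x _.
  by rewrite gee0_abs ?lee_fin ?sqr_ge0//; over.
by [].
Qed.

Let J0 a b : (forall x, 0 <= a x) -> (forall x, 0 <= b x) -> 0 <= J a b.
Proof. by move=> a0 b0; apply: integral_ge0 => x _; rewrite mule_ge0. Qed.

Let total_le (t : R) : (0 <= t)%R ->
  J (heat0 t (f \+ h)) (f \+ h) <= \int[m]_x (u x ^+ 2)%:E.
Proof.
move=> t0; rewrite -absabs /heat0; case: eqP => // /eqP t1.
apply: heat_sq_le => //.
- by rewrite lt_neqAle eq_sym t1.
- exact: emeasurable_funD.
- by move=> x; rewrite adde_ge0.
Qed.

Let fin_form (t : R) : (0 <= t)%R -> [/\ J (heat0 t f) f \is a fin_num,
  J (heat0 t f) h \is a fin_num & J (heat0 t h) h \is a fin_num].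
Proof.
move=> t0.
have ff0 := J0 (heat0_ge0 t0 f0) f0.
have fh0 := J0 (heat0_ge0 t0 f0) h0.
have hh0 := J0 (heat0_ge0 t0 h0) h0.
have := le_lt_trans (total_le t0) u2_fin; rewrite (expand t0).
exact: (fin_num_parts ff0 fh0 hh0).
Qed.

(* This is <p_t u, u>, expanded over the positive and negative parts of u so that
   Tonelli's theorem suffices throughout. *)
Definition energy_form (t : R) : R :=
  (fine (J (heat0 t f) f) + fine (J (heat0 t h) h) - 2 * fine (J (heat0 t f) h))%R.

Lemma energy_form0 : (energy_form 0)%:E = \int[m]_x (u x ^+ 2)%:E.
Proof.
have [ff fh hh] := fin_form (lexx _).
have fh0 : J (heat0 0 f) h = 0.
  rewrite /heat0 eqxx; under eq_integral => x _.
    rewrite /f /h !funeposE !funenegE/= -!EFin_max -EFinM (_ : (_ * _)%R = 0%R).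
      over.
    case: (leP 0%R (u x)) => ux.
      by rewrite (@max_r _ _ (- u x)%R) ?mulr0 ?oppr_le0.
    by rewrite mul0r.
  exact: integral0.
rewrite /energy_form fh0 /= mulr0 subr0 EFinD !fineK// -absabs.
have := expand (lexx 0%R); rewrite /heat0 eqxx => ->.
by move: fh0; rewrite /heat0 eqxx => ->; rewrite adde0 add0e.
Qed.

Let absE (t : R) : (0 < t)%R ->
  \int[m]_x (heat m p t (fun y => `|u y|%:E) x * `|u x|%:E) =
  J (heat0 t (f \+ h)) (f \+ h).
Proof.
move=> t0; rewrite /heat0 (gt_eqF t0) -fhE.
by apply: eq_integral => x _; rewrite /= fhx.
Qed.

(** Passing to |u| only changes the sign of the nonnegative cross terms. The right-hand side is the
    one to which the Schur test applies. *)
Lemma energy_form_le_abs (t : R) : (0 < t)%R ->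
  (energy_form t)%:E <=
  \int[m]_x (heat m p t (fun y => `|u y|%:E) x * `|u x|%:E).
Proof.
move=> t0; have [ff fh hh] := fin_form (ltW t0).
have fh0 := J0 (heat0_ge0 (ltW t0) f0) h0.
rewrite absE// (expand (ltW t0)) /energy_form.
exact: (fine_parts_le ff fh hh fh0).
Qed.

Lemma energy_form_bounded (t : R) : (0 <= t)%R -> (energy_form t <= energy_form 0)%R.
Proof.
rewrite le_eqVlt => /predU1P[<-|t0]; first exact: lexx.
have := energy_form_le_abs t0; rewrite (absE t0) => le1.
have le2 := le_trans le1 (total_le (ltW t0)).
by move: le2; rewrite -energy_form0 lee_fin.
Qed.

(** p_s u - p_t u is the difference of p_s f + p_t h and p_s h + p_t f. Both are nonnegative, so the
    positivity of its square can be stated without subtracting functions. *)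
Lemma energy_form_midpoint (s t : R) : (0 <= s)%R -> (0 <= t)%R ->
  (2 * energy_form (s + t) <= energy_form (s + s) + energy_form (t + t))%R.
Proof.
move=> s0 t0.
have [ff1 fh1 hh1] := fin_form (addr_ge0 s0 t0).
have [ff2 fh2 hh2] := fin_form (addr_ge0 s0 s0).
have [ff3 fh3 hh3] := fin_form (addr_ge0 t0 t0).
have Ecb := heat0_mul t0 s0 mf f0 mh h0.
rewrite (addrC t s) in Ecb.
have := integral_mul_AGM4
  (measurable_heat0 s0 mf f0) (heat0_ge0 s0 f0)
  (measurable_heat0 s0 mh h0) (heat0_ge0 s0 h0)
  (measurable_heat0 t0 mf f0) (heat0_ge0 t0 f0)
  (measurable_heat0 t0 mh h0) (heat0_ge0 t0 h0)
  (etrans (heat0_mul s0 s0 mf f0 mh h0) (esym (fineK fh2)))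
  (etrans (heat0_mul s0 t0 mf f0 mf f0) (esym (fineK ff1)))
  (etrans (heat0_mul s0 t0 mh h0 mh h0) (esym (fineK hh1)))
  (etrans (heat0_mul t0 t0 mf f0 mh h0) (esym (fineK fh3)))
  (etrans (heat0_mul s0 s0 mf f0 mf f0) (esym (fineK ff2)))
  (etrans (heat0_mul s0 t0 mf f0 mh h0) (esym (fineK fh1)))
  (etrans (heat0_mul s0 s0 mh h0 mh h0) (esym (fineK hh2)))
  (etrans Ecb (esym (fineK fh1)))
  (etrans (heat0_mul t0 t0 mf f0 mf f0) (esym (fineK ff3)))
  (etrans (heat0_mul t0 t0 mh h0 mh h0) (esym (fineK hh3))).
exact: energy_form_midpoint_aux.
Qed.

Lemma transition_opE (t : R) x : (0 < t)%R ->
  transition_op m p t u x = heat m p t f x - heat m p t h x.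
Proof.
move=> t0; rewrite /transition_op integralE /heat.
have pt y : 0 <= p t x y by exact: (td_ge0 p_td).
have maxM a (z : \bar R) : 0 <= a -> maxe (a * z) 0 = a * maxe z 0.
  move=> a0; case: (leP 0 z) => z0.
    by rewrite (max_idPl _)// mule_ge0.
  by rewrite mule0; apply/max_idPr; rewrite mule_ge0_le0// ltW.
by congr (_ - _); apply: eq_integral => y _;
  rewrite /f /h !(funeposE, funenegE)/= -?muleN maxM.
Qed.

Lemma energy_formE (t : R) : (0 < t)%R ->
  \int[m]_x (((u x)%:E - transition_op m p t u x) * (u x)%:E) =
  (energy_form 0 - energy_form t)%:E.
Proof.
move=> t0.
pose a := heat m p t f; pose b := heat m p t h.
have aE : heat0 t f = a by rewrite /heat0 (gt_eqF t0).
have bE : heat0 t h = b by rewrite /heat0 (gt_eqF t0).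
have [ff fh hh] := fin_form (ltW t0).
have [] : [/\ J a f \is a fin_num, J a h \is a fin_num & J b h \is a fin_num].
  by rewrite -aE -bE.
move=> {}ff {}fh {}hh.
have a0 : forall x, 0 <= a x by move=> x; apply: (heat_ge0 p_td f0 x t0).
have b0 : forall x, 0 <= b x by move=> x; apply: (heat_ge0 p_td h0 x t0).
have ma : measurable_fun [set: T] a by exact: (measurable_heat p_td mf f0 t0).
have mb : measurable_fun [set: T] b by exact: (measurable_heat p_td mh h0 t0).
have bfE : J b f = J a h.
  exact: (etrans (heat_sym p_td t0 mh h0 mf f0) (integral_mulC m h a)).
have IM (c e : T -> \bar R) : measurable_fun [set: T] c -> (forall x, 0 <= c x) ->
    measurable_fun [set: T] e -> (forall x, 0 <= e x) ->
    J c e \is a fin_num -> m.-integrable [set: T] (fun x => c x * e x).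
  move=> mc c0 me e0 ce; apply/integrableP; split; first exact: emeasurable_funM.
  under eq_integral do rewrite gee0_abs ?mule_ge0//.
  by rewrite -(ge0_fin_numE (J0 c0 e0)).
have Iaf := IM a f ma a0 mf f0 ff.
have Iah := IM a h ma a0 mh h0 fh.
have Ibh := IM b h mb b0 mh h0 hh.
have fbf : J b f \is a fin_num by rewrite bfE.
have Ibf := IM b f mb b0 mf f0 fbf.
have Iahbf := integrableD measurableT Iah Ibf.
pose X x := (u x ^+ 2)%:E + (a x * h x + b x * f x).
pose Y x := a x * f x + b x * h x.
have IX : m.-integrable [set: T] X by exact: (integrableD measurableT u2 Iahbf).
have IY : m.-integrable [set: T] Y by exact: (integrableD measurableT Iaf Ibh).
have opE : transition_op m p t u = (fun x => a x - b x).
  by apply/funext => x; exact: transition_opE.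
have muE : measurable_fun [set: T] (fun x => (u x)%:E).
  exact/measurable_EFinP.
(* The integrands agree wherever [Y] is finite, hence almost everywhere; elsewhere +oo - +oo could
   spoil the expansion of the product. *)
have FE : \int[m]_x (((u x)%:E - transition_op m p t u x) * (u x)%:E) =
    \int[m]_x (X x - Y x).
  rewrite opE; apply: ae_eq_integral; first exact: measurableT.
  - apply: (emeasurable_funM _ muE); apply: (emeasurable_funB muE).
    exact: (emeasurable_funB ma mb).
  - exact: (emeasurable_funB (measurable_int _ IX) (measurable_int _ IY)).
  - have := integrable_ae measurableT IY; apply: filterS => x /(_ I) Yfin _.
    move: Yfin; rewrite /X /Y /f /h !funeposE !funenegE/=.
    exact: sub_mul_posneg.
have EX : \int[m]_x X x = \int[m]_x (u x ^+ 2)%:E + (J a h + J b f).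
  apply: (etrans (integralD measurableT u2 Iahbf)); congr (_ + _).
  exact: (integralD measurableT Iah Ibf).
have EY : \int[m]_x Y x = J a f + J b h.
  exact: (integralD measurableT Iaf Ibh).
have gE : energy_form t = (fine (J a f) + fine (J b h) - 2 * fine (J a h))%R.
  by rewrite /energy_form aE bE.
rewrite FE (integralB measurableT IX IY) EX EY bfE gE -energy_form0.
exact: (fine_parts_sub (energy_form 0) ff fh hh).
Qed.

(** The quotient is nonincreasing in t, so its right limit at 0 exists, is not a default value, and
    equals its supremum. *)
Lemma energy_quotient_le_dirichlet (t : R) : (0 < t)%R ->
  ((energy_form 0 - energy_form t) / t)%:E <= dirichlet_form m p u.
Proof.
move=> t0; rewrite /dirichlet_form.
pose q (s : R) : \bar R := ((energy_form 0 - energy_form s) / s)%:E.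
have qE : (s^-1)%:E *
    (\int[m]_x (((u x)%:E - transition_op m p s u x) * (u x)%:E))
    @[s --> (0 : R)%R^'+] --> ereal_sup (q @` `]0%R, +oo[%classic).
  apply: cvg_trans; last first.
    apply: (@nonincreasing_at_right_cvge _ q 0%R +oo%O) => //.
    move=> r s; rewrite !in_itv/= !andbT => r0 s0 rs; rewrite lee_fin.
    exact: (bounded_midpoint_convex_slope energy_form_midpoint
      energy_form_bounded).
  apply: near_eq_cvg; near=> s; rewrite energy_formE// /q EFinM muleC//.
rewrite (cvg_lim _ qE)//.
apply: ereal_sup_ubound; exists t => //=; by rewrite in_itv/= andbT.
Unshelve. all: by end_near. Qed.

End energy.

(** * Weighted series *)

Lemma nneseries_le_bound {R : realType} (f : nat -> \bar R) (c : \bar R) :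
  (forall k, 0 <= f k)%E -> (forall n, \sum_(0 <= k < n) f k <= c)%E ->
  (\sum_(0 <= k <oo) f k <= c)%E.
Proof.
move=> f0 fc; apply: lime_le; first by apply: is_cvg_nneseries => *; exact: f0.
by apply: nearW => n; exact: fc.
Qed.

(** The discrete form of integrating s^(-1-e) over [n, n+1]. With N = n+1 it reduces to (1 -
    1/N)^(-e) >= 1 + e/N, from exp(x) >= 1 + x and ln(1 - x) <= -x. *)
Lemma powR_telescope {R : realType} (e : R) (n : nat) : 0 < e -> (0 < n)%N ->
  n.+1%:R `^ (- (1 + e)) <= e^-1 * (n%:R `^ (- e) - n.+1%:R `^ (- e)).
Proof.
move=> e0 n0; have N0 : 0 < n%:R :> R by rewrite ltr0n.
have N1 : 0 < n.+1%:R :> R by [].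
rewrite ler_pdivlMl// opprD powRD; last by apply/implyP => _; rewrite gt_eqF.
rewrite powR_inv1 ?(ltW N1)// mulrA.
have -> : n%:R = n.+1%:R * (1 - n.+1%:R^-1) :> R.
  by rewrite mulrBr mulr1 divff ?gt_eqF// -natr1 addrK.
have x1 : n.+1%:R^-1 < 1 :> R by rewrite invf_lt1// ltr1n.
have x0 : 0 < n.+1%:R^-1 :> R by rewrite invr_gt0.
rewrite powRM ?(ltW N1) ?subr_ge0 ?(ltW x1)// -[X in _ <= _ - X]mulr1 -mulrBr mulrC.
rewrite ler_wpM2l ?powR_ge0// lerBrDr.
rewrite /powR subr_eq0 gt_eqF//.
apply: le_trans (expR_ge1Dx _); rewrite addrC lerD2l mulNr -mulrN.
rewrite ler_wpM2l ?(ltW e0)// lerNr; apply: le_ln1Dx.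
by rewrite ltrNl opprK.
Qed.

Section weighted_series.
Context {R : realType}.
Variables (e C1 C2 c3 v : R) (K : nat) (q : nat -> \bar R).
Hypotheses (e0 : 0 < e) (C10 : 0 < C1) (C20 : 0 < C2) (c30 : 0 < c3) (v0 : 0 < v).
Hypotheses (K0 : (0 < K)%N) (q0 : forall k, (0 <= q k)%E).
Hypothesis q_small : forall k, (k < K)%N -> (q k <= (C1 * v)%:E)%E.
Hypothesis q_large : forall k, (K <= k)%N ->
  (q k <= (C2 * v * (K%:R / k.+1%:R) `^ (1 + 2 * e))%:E)%E.
Hypothesis q_middle : forall k, (k < K)%N -> (K <= k.+1 * 2)%N ->
  ((c3 * v)%:E <= q k)%E.

(** In the application [q] k is the kernel at time (k+1) t and [v] is 1/V(r). The [K] terms before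
    the cut are at most C1 v K^e each; after it the terms decay like (k+1)^(-(1+e)) and
    telescope. *)
Lemma weighted_series_le :
  (\sum_(0 <= k <oo) ((k.+1%:R `^ e)%:E * q k) <=
   ((C1 + C2 / e) * v * K%:R `^ (1 + e))%:E)%E.
Proof.
have KR : 0 < K%:R :> R by rewrite ltr0n.
have pK : K%:R `^ (1 + e) = K%:R * K%:R `^ e :> R.
  by rewrite powRD ?powRr1 ?(ltW KR)// (gt_eqF KR) implybT.
have part1 n : (n <= K)%N -> (\sum_(0 <= k < n) ((k.+1%:R `^ e)%:E * q k) <=
   (n%:R * (C1 * v * K%:R `^ e))%:E)%E.
  elim: n => [|n IH] nK; first by rewrite big_geq// mul0r.
  rewrite big_nat_recr//= -natr1 mulrDl mul1r EFinD; apply: leeD.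
    by apply: IH; exact: ltnW.
  rewrite [C1 * v * _]mulrC EFinM; apply: lee_pmul => //.
  - by rewrite lee_fin ge0_ler_powR ?nnegrE ?(ltW e0)// natr1 ler_nat.
  - exact: q_small.
(* Keeping the subtracted power of K + j makes the induction step a single use of
   [powR_telescope]. *)
have part2 j : (\sum_(0 <= k < K + j) ((k.+1%:R `^ e)%:E * q k) <=
   (C1 * v * K%:R `^ (1 + e) + C2 * v * K%:R `^ (1 + 2 * e) *
     (e^-1 * (K%:R `^ (- e) - (K + j)%:R `^ (- e))))%:E)%E.
  elim: j => [|j IH].
    rewrite addn0 subrr !mulr0 addr0 pK mulrCA.
    exact: part1.
  rewrite addnS big_nat_recr//=; apply: le_trans (leeD IH (le_refl _)) _.
  have Kj : (K <= K + j)%N by rewrite leq_addr.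
  have N0 : 0 < (K + j).+1%:R :> R by [].
  apply: (@le_trans _ _ (_ + ((K + j).+1%:R `^ e)%:E *
     (C2 * v * (K%:R / (K + j).+1%:R) `^ (1 + 2 * e))%:E)%E).
    by apply: leeD => //; rewrite lee_wpmul2l ?lee_fin ?powR_ge0// q_large.
  rewrite -EFinM -EFinD lee_fin -addrA lerD2l.
  have -> : (K + j).+1%:R `^ e * (C2 * v * (K%:R / (K + j).+1%:R) `^ (1 + 2 * e))
     = C2 * v * K%:R `^ (1 + 2 * e) * (K + j).+1%:R `^ (- (1 + e)).
    rewrite powRM ?ltW// ?invr_gt0// -powR_inv1 ?ltW// -powRrM mulN1r.
    rewrite mulrCA -!mulrA; congr (_ * (_ * _)); rewrite mulrCA; congr (_ * _).
    rewrite -powRD; last by apply/implyP => _; rewrite gt_eqF.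
    by congr (_ `^ _); ring.
  rewrite -mulrDr ler_wpM2l ?mulr_ge0 ?powR_ge0 ?(ltW C20) ?(ltW v0)//.
  have := @powR_telescope _ e (K + j) e0 (leq_trans K0 Kj).
  by rewrite !mulrBr; lra.
apply: nneseries_le_bound => [k|n].
  by rewrite mule_ge0// lee_fin powR_ge0.
apply: (@le_trans _ _ (\sum_(0 <= k < K + n) ((k.+1%:R `^ e)%:E * q k))%E).
  rewrite (@big_cat_nat _ _ _ n _ (K + n)) ?leq_addl//= leeDl// sume_ge0// => k _.
  by rewrite mule_ge0// lee_fin powR_ge0.
apply: (le_trans (part2 n)); rewrite lee_fin [(C1 + _) * v]mulrDl [(C1 * v + _) * _]mulrDl lerD2l.
have -> : C2 / e * v * K%:R `^ (1 + e) =
    C2 * v * K%:R `^ (1 + 2 * e) * (e^-1 * K%:R `^ (- e)).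
  have -> : K%:R `^ (1 + e) = K%:R `^ (1 + 2 * e) * K%:R `^ (- e) :> R.
    rewrite -powRD; last by apply/implyP => _; rewrite gt_eqF.
    by congr (_ `^ _); ring.
  by rewrite !mulrA; congr (_ * _); rewrite -!mulrA; congr (_ * _); rewrite mulrC -mulrA.
rewrite ler_wpM2l ?mulr_ge0 ?powR_ge0 ?(ltW C20) ?(ltW v0)// ler_wpM2l ?invr_ge0 ?(ltW e0)//.
by rewrite lerBlDr lerDl powR_ge0.
Qed.

(** Only the indices from floor(K/2) to K - 1 are kept; they satisfy 2(k+1) >= K for either parity
    of K. The weights telescope to K^e - floor(K/2)^e. *)
Lemma weighted_series_diff_ge :
  ((c3 * v * (1 - 2^-1 `^ e) * K%:R `^ e)%:E <=
  \sum_(0 <= k <oo) ((k.+1%:R `^ e - k%:R `^ e)%:E * q k))%E.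
Proof.
have w0 k : 0 <= k.+1%:R `^ e - k%:R `^ e :> R.
  by rewrite subr_ge0 ge0_ler_powR ?nnegrE ?(ltW e0)// ler_nat.
have d0 k : (0 <= (k.+1%:R `^ e - k%:R `^ e)%:E * q k)%E.
  by rewrite mule_ge0// lee_fin.
apply: le_trans (@nneseries_lim_ge _ _ xpredT 0%N K (fun k _ _ => d0 k)).
pose J := K./2.
have JK : (J <= K)%N by rewrite /J -{2}(odd_double_half K) -addnn addnA leq_addl.
rewrite (@big_cat_nat _ _ _ J)//=.
apply: (@le_trans _ _ (\sum_(J <= k < K) ((k.+1%:R `^ e - k%:R `^ e)%:E * q k))%E); last first.
  by rewrite leeDr// sume_ge0.
apply: (@le_trans _ _ (\sum_(J <= k < K) ((k.+1%:R `^ e - k%:R `^ e) * (c3 * v))%:E)%E); last first.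
  rewrite big_nat_cond [leRHS]big_nat_cond; apply: lee_sum => k /andP[/andP[Jk kK] _].
  rewrite EFinM lee_wpmul2l ?lee_fin//; apply: q_middle => //.
  rewrite -(odd_double_half K) -/J muln2 doubleS.
  rewrite -addn2 addnC leq_add// ?leq_double//.
  by case: odd.
rewrite sumEFin -mulr_suml telescope_sumr// lee_fin [leRHS]mulrC -[leLHS]mulrA.
rewrite ler_wpM2l ?mulr_ge0 ?(ltW c30) ?(ltW v0)// mulrBl mul1r lerD2l lerN2 -powRM ?invr_ge0//.
rewrite ge0_ler_powR ?nnegrE ?(ltW e0) ?mulr_ge0 ?invr_ge0//.
rewrite ler_pdivlMl// -natrM ler_nat mul2n.
by rewrite -[leqRHS]odd_double_half leq_addl.
Qed.

Lemma weighted_series_compare :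
  ((c3 * (1 - 2^-1 `^ e) / (C1 + C2 / e) / K%:R)%:E *
   \sum_(0 <= k <oo) ((k.+1%:R `^ e)%:E * q k) <=
   \sum_(0 <= k <oo) ((k.+1%:R `^ e - k%:R `^ e)%:E * q k))%E.
Proof.
have KR : 0 < K%:R :> R by rewrite ltr0n.
have a0 : 0 < C1 + C2 / e by rewrite addr_gt0// divr_gt0.
have b0 : 0 <= 1 - 2^-1 `^ e :> R.
  by rewrite subr_ge0 -[leRHS](congr1 (@^~ e) (powR1 R)) ge0_ler_powR ?nnegrE ?(ltW e0) ?invf_le1 ?ler1n ?invr_ge0.
apply: (le_trans _ weighted_series_diff_ge).
apply: (le_trans (lee_wpmul2l _ weighted_series_le)).
  by rewrite lee_fin !divr_ge0 ?mulr_ge0// ltW.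
rewrite -EFinM lee_fin powRD ?powRr1 ?(ltW KR) ?(gt_eqF KR) ?implybT//.
rewrite le_eqVlt; apply/orP; left; apply/eqP.
move: (C1 + C2 / e) a0 (K%:R `^ e) (2^-1 `^ e) => S S0 w z.
by field; rewrite ?gt_eqF// (gt_eqF KR) (gt_eqF S0).
Qed.

End weighted_series.

(** * The ground state inequality *)

Lemma le_fin_diff {R : realType} (a b : R) (x y : \bar R) :
  (a%:E <= x -> b%:E = x + y -> y <= (b - a)%:E)%E.
Proof.
case: x => [x| |]//; case: y => [y| |]//; rewrite ?leNye//.
by rewrite -EFinD !lee_fin => ax [->]; lra.
Qed.

(** The factor +oo is included because the kernel p_t(x, z) by which the series is multiplied may be
    infinite. *)
Lemma nneseries_mull {R : realType} (c : \bar R) (f : nat -> \bar R) :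
  (0 <= c -> (forall k, 0 <= f k) ->
  \sum_(0 <= k <oo) (c * f k) = c * \sum_(0 <= k <oo) f k)%E.
Proof.
case: c => [c|_ f0|]//; first by move=> _ f0; exact: nneseriesZl.
have [[k fk]|f_eq0] := pselect (exists k, (0 < f k)%E).
  have -> : (\sum_(0 <= k <oo) (+oo * f k) = +oo)%E.
    apply: (@nneseries_pinfty _ _ xpredT k) => // [n _|].
      by rewrite mule_ge0.
    by rewrite gt0_mulye.
  rewrite gt0_mulye// (lt_le_trans fk)//.
  by rewrite (@nneseriesD1 _ f k xpredT)// leeDl// nneseries_ge0.
have fE k : f k = 0%E.
  apply/eqP; rewrite eq_le f0 andbT leNgt; apply/negP => fk.
  by apply: f_eq0; exists k.
by rewrite !eseries0 ?mule0// => k _ _; rewrite fE ?mule0.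
Qed.

Section ground_state.
Context d (T : measurableType d) (R : realType).
Variables (m : {sigma_finite_measure set T -> \bar R}).
Variables (p : R -> T -> T -> \bar R).
Hypothesis p_td : transition_density m p.
Local Open Scope ereal_scope.

Section bound.
Variable u : T -> R.
Hypothesis u2 : m.-integrable [set: T] (fun x => (u x ^+ 2)%:E).
Hypothesis mu : measurable_fun [set: T] u.
Variables (t : R) (h D : T -> \bar R) (N : set T).
Hypotheses (t0 : (0 < t)%R).
Hypotheses (mh : measurable_fun [set: T] h) (h0 : forall x, 0 < h x).
Hypotheses (mD : measurable_fun [set: T] D) (D0 : forall x, 0 <= D x).
Hypothesis heat_h : forall x, heat m p t h x + D x = h x.
Hypotheses (mN : measurable N) (N0 : m N = 0).
Hypothesis h_fin : forall x, ~ N x -> h x < +oo.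

(* k = u^2 / h off N; the value +oo on the null set N makes the Schur test
   applicable although h may be infinite there. *)
Let k (x : T) : \bar R :=
  (u x ^+ 2 * (fine (h x))`^(-1))%:E + (\1_N x)%:E * +oo.

Let mk : measurable_fun [set: T] k.
Proof.
apply: emeasurable_funD.
  apply/measurable_EFinP; apply: measurable_funM; first exact: measurable_funX.
  apply: (measurableT_comp (measurable_powR (-1))); exact: measurableT_comp.
apply: emeasurable_funM => //.
by apply/measurable_EFinP; exact: measurable_indic.
Qed.

Let k0 x : 0 <= k x.
Proof.
apply: adde_ge0; first by rewrite lee_fin mulr_ge0 ?sqr_ge0 ?powR_ge0.
by apply: mule_ge0; rewrite ?lee_fin// indicE.
Qed.

Let kN x : N x -> k x = +oo.
Proof. by move=> Nx; rewrite /k indicE mem_set// mul1e addey. Qed.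

Let hfineE x : ~ N x -> exists2 a : R, (0 < a)%R & h x = a%:E.
Proof.
move=> Nx; move: (h0 x) (h_fin Nx); case: (h x) => // a a0 _.
by exists a.
Qed.

Let knN x a : ~ N x -> h x = a%:E -> (0 < a)%R -> k x = (u x ^+ 2 / a)%:E.
Proof.
move=> Nx hx a0; rewrite /k indicE memNset// mul0e adde0 hx/=.
by rewrite powR_inv1// ltW.
Qed.

(** On [N] the right-hand side is +oo, since h > 0. Off [N] the two sides differ by the square (v b
    - w a)^2/(a b). *)
Let kh_dom x z : 2%:E * (`|u x|%:E * `|u z|%:E) <= k x * h z + k z * h x.
Proof.
have [Nx|Nx] := pselect (N x).
  by rewrite (kN Nx) gt0_mulye// addye ?leey// gt_eqF// (lt_le_trans ltNy0)// mule_ge0// ltW.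
have [Nz|Nz] := pselect (N z).
  by rewrite (kN Nz) gt0_mulye// addey ?leey// gt_eqF// (lt_le_trans ltNy0)// mule_ge0// ltW.
have [a a0 hx] := hfineE Nx; have [b b0 hz] := hfineE Nz.
rewrite (knN Nx hx a0) (knN Nz hz b0) hx hz -!EFinM -EFinD lee_fin.
rewrite -[(u x ^+ 2)%R]real_normK ?num_real// -[(u z ^+ 2)%R]real_normK ?num_real//.
move: `|u x|%R `|u z|%R => v w.
have -> : (v ^+ 2 / a * b + w ^+ 2 / b * a =
    2 * (v * w) + (v * b - w * a) ^+ 2 / (a * b))%R.
  by field; rewrite (gt_eqF a0) (gt_eqF b0).
by rewrite lerDl divr_ge0 ?sqr_ge0// mulr_ge0// ltW.
Qed.

Let hge0 x : 0 <= h x. Proof. exact: ltW. Qed.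

Let mheat : measurable_fun [set: T] (heat m p t h).
Proof. exact: (measurable_heat p_td mh hge0 t0). Qed.
Let heat0' x : 0 <= heat m p t h x.
Proof. exact: (heat_ge0 p_td hge0 x t0). Qed.

(** The identity p_t h + D = h is multiplied by [k]; k h = u^2 holds off the null set [N]. *)
Let int_kh : \int[m]_x (k x * heat m p t h x) + \int[m]_x (k x * D x) =
  \int[m]_x (u x ^+ 2)%:E.
Proof.
rewrite -(integral_mulDr _ mheat heat0' mD D0 mk k0).
apply: ge0_ae_eq_integral => //.
- by apply: emeasurable_funM => //; exact: emeasurable_funD.
- exact: measurable_int u2.
- by move=> x _; rewrite mule_ge0// adde_ge0.
- by move=> x _; rewrite lee_fin sqr_ge0.
exists N; split => // x /=; apply: contra_notP => Nx _.
rewrite heat_h; have [a a0 hx] := hfineE Nx.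
by rewrite (knN Nx hx a0) hx -EFinM divfK// gt_eqF.
Qed.

(** The Schur test bounds <p_t |u|, |u|> by the integral of k p_t h; by [int_kh] what it leaves of
    the norm of u is the integral of k D, that is, of u^2 D/h. The minorant [r] of D/h enters as r h
    <= D, which avoids an extended quotient. *)
Lemma ground_state_energy (S : set T) (r : T -> R) : measurable S ->
  (forall x, S x -> ~ N x) -> measurable_fun S r ->
  (forall x, S x -> (0 <= r x)%R) ->
  (forall x, S x -> (r x)%:E * h x <= D x) ->
  \int[m]_(x in S) (u x ^+ 2 * r x)%:E <=
  (energy_form m p u 0 - energy_form m p u t)%:E.
Proof.
move=> mS SN mr r0 rh.
have mkD : measurable_fun [set: T] (fun x => k x * D x).
  exact: emeasurable_funM.
have kD0 x : 0 <= k x * D x by rewrite mule_ge0.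
have SkD : \int[m]_(x in S) (u x ^+ 2 * r x)%:E <= \int[m]_x (k x * D x).
  apply: (@le_trans _ _ (\int[m]_(x in S) (k x * D x))); last first.
    exact: ge0_subset_integral.
  apply: ge0_le_integral => //.
  - by move=> x Sx; rewrite lee_fin mulr_ge0 ?sqr_ge0// r0.
  - apply/measurable_EFinP; apply: measurable_funM => //.
    by apply: measurable_funS (measurable_funX _ mu) => //.
  - exact: measurable_funS mkD.
  - move=> x Sx; have [a a0 hx] := hfineE (SN _ Sx).
    rewrite (knN (SN _ Sx) hx a0).
    apply: le_trans (lee_wpmul2l _ (rh _ Sx)); last first.
      by rewrite lee_fin divr_ge0 ?sqr_ge0// ltW.
    by rewrite hx -!EFinM lee_fin mulrCA mulrC -!mulrA mulVf ?gt_eqF// mulr1 mulrC.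
have mabs : measurable_fun [set: T] (fun x => `|u x|%:E).
  by apply/measurable_EFinP; exact: measurableT_comp.
have abs0 x : 0 <= `|u x|%:E by rewrite lee_fin.
have schur := schur_test p_td t0 mabs abs0 mk k0 mh hge0 kh_dom.
have gt_le := le_trans (energy_form_le_abs p_td u2 mu t0) schur.
have g0E := energy_form0 p_td u2 mu.
exact: le_trans SkD (le_fin_diff gt_le (etrans g0E (esym int_kh))).
Qed.

End bound.

(** * The discrete potential of the pole and its drop under one time step *)

Section discrete_potential.
Variables (t e : R) (y : T).
Hypotheses (t0 : (0 < t)%R) (e0 : (0 < e)%R).

Definition potential (x : T) : \bar R :=
  \sum_(0 <= k <oo) ((k.+1%:R `^ e)%:E * p (k.+1%:R * t) x y).

Definition potential_drop (x : T) : \bar R :=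
  \sum_(0 <= k <oo) ((k.+1%:R `^ e - k%:R `^ e)%:E * p (k.+1%:R * t) x y).

Let kt0 k : (0 < k.+1%:R * t)%R. Proof. by rewrite mulr_gt0. Qed.

Let q0 k x : 0 <= p (k.+1%:R * t) x y.
Proof. exact: (td_ge0 p_td). Qed.

Let w0 k : (0 <= k.+1%:R `^ e - k%:R `^ e :> R)%R.
Proof. by rewrite subr_ge0 ge0_ler_powR ?nnegrE ?(ltW e0)// ler_nat. Qed.

Let mq k : measurable_fun [set: T] (fun x => p (k.+1%:R * t) x y).
Proof.
rewrite (_ : (fun x => _) = p (k.+1%:R * t) y); last first.
  by apply/funext => x; rewrite (td_sym p_td).
exact: (measurable_density2 p_td).
Qed.

Lemma measurable_potential : measurable_fun [set: T] potential.
Proof.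
apply: (@ge0_emeasurable_sum _ _ _ _ _ xpredT) => [k x _ _|k _].
  by rewrite mule_ge0// lee_fin powR_ge0.
by apply: emeasurable_funM.
Qed.

Lemma measurable_potential_drop : measurable_fun [set: T] potential_drop.
Proof.
apply: (@ge0_emeasurable_sum _ _ _ _ _ xpredT) => [k x _ _|k _].
  by rewrite mule_ge0// lee_fin.
by apply: emeasurable_funM.
Qed.

Lemma potential_ge x : p t x y <= potential x.
Proof.
have := @nneseries_lim_ge _ (fun k => (k.+1%:R `^ e)%:E * p (k.+1%:R * t) x y)
  xpredT 0%N 1%N.
rewrite big_nat1 powR1 mul1e mul1r; apply => k _ _.
by rewrite mule_ge0// lee_fin powR_ge0.
Qed.

Lemma potential_drop_ge0 x : 0 <= potential_drop x.
Proof. by apply: nneseries_ge0 => k _ _; rewrite mule_ge0// lee_fin. Qed.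

(** p_t moves the term of time (k+1) t to time (k+2) t, so p_t h carries the weight k^e at time
    (k+1) t; as e > 0, 0^e = 0 fills the vacant first place. The sum form stays valid where h is
    infinite. *)
Lemma heat_potential x : heat m p t potential x + potential_drop x = potential x.
Proof.
have -> : heat m p t potential x =
    \sum_(0 <= k <oo) ((k.+1%:R `^ e)%:E * p (k.+2%:R * t) x y).
  rewrite /heat /potential.
  transitivity (\int[m]_z \sum_(0 <= k <oo)
      (p t x z * ((k.+1%:R `^ e)%:E * p (k.+1%:R * t) z y))).
    apply: eq_integral => z _; rewrite nneseries_mull ?(td_ge0 p_td)//.
    by move=> k; rewrite mule_ge0// lee_fin powR_ge0.
  rewrite integral_nneseries//.
  - apply: eq_eseriesr => k _.
    transitivity (\int[m]_z ((k.+1%:R `^ e)%:E *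
      (p t x z * p (k.+1%:R * t) z y))).
      by apply: eq_integral => z _; rewrite muleCA.
    rewrite ge0_integralZl//.
    + rewrite (td_chapman_kolmogorov p_td)// -[k.+2%:R]nat1r mulrDl mul1r//.
    + apply: emeasurable_funM => //; exact: (measurable_density2 p_td).
    + by move=> z _; rewrite mule_ge0// (td_ge0 p_td).
  - move=> k; apply: emeasurable_funM; first exact: (measurable_density2 p_td).
    exact: emeasurable_funM.
  - by move=> k z _; rewrite !mule_ge0 ?lee_fin ?powR_ge0// (td_ge0 p_td).
pose f k : \bar R := (k%:R `^ e)%:E * p (k.+1%:R * t) x y.
have f0 k : 0 <= f k by rewrite mule_ge0// lee_fin powR_ge0.
have -> : \sum_(0 <= k <oo) ((k.+1%:R `^ e)%:E * p (k.+2%:R * t) x y) =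
    \sum_(0 <= k <oo) f k.
  rewrite [RHS]nneseries_recl// {1}/f powR0 ?gt_eqF// mul0e add0e.
  rewrite -(@nneseries_addn _ f 1%N f0); apply: eq_eseriesr => k _.
  by rewrite /f addn1.
rewrite /potential_drop -nneseriesD//; last first.
  by move=> k _ _; rewrite mule_ge0// lee_fin.
apply: eq_eseriesr => k _; rewrite /f -ge0_muleDl ?lee_fin ?powR_ge0//.
by rewrite -EFinD addrC subrK.
Qed.

End discrete_potential.
End ground_state.

(** * Heat kernel estimates *)

Section kernel_estimates.
Context {R : realType}.
Variables (phi V : R -> R) (A alpha CV cphi : R).
Hypothesis phi_scale : scale_function phi.
Hypothesis V_scale : scale_function V.
Hypothesis phi_infty : phi s @[s --> +oo] --> +oo.
Hypothesis alpha_gt0 : 0 < alpha.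
Hypothesis alpha_lt_A : alpha < A.
Hypothesis V_wlsc : wlsc A CV V.
Hypothesis phi_wusc : wusc alpha cphi phi.

Local Notation hke := (heat_kernel_estimate phi V).

Let phi_gt0 r : 0 < r -> 0 < phi r. Proof. by case: phi_scale => _ + _; exact. Qed.
Let V_gt0 r : 0 < r -> 0 < V r. Proof. by case: V_scale => _ + _; exact. Qed.
Let phi_le r s : 0 <= r -> r <= s -> phi r <= phi s.
Proof. by case: phi_scale => _ _; exact. Qed.
Let V_le r s : 0 <= r -> r <= s -> V r <= V s.
Proof. by case: V_scale => _ _; exact. Qed.
Let V_ge0 r : 0 <= r -> 0 <= V r.
Proof. by case: V_scale => V0 _ _ r0; rewrite -{1}V0; exact: V_le. Qed.
Let phi_ge0 r : 0 <= r -> 0 <= phi r.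
Proof. by case: phi_scale => V0 _ _ r0; rewrite -{1}V0; exact: phi_le. Qed.

(** This is where phi -> +oo enters: the [inf] in the generalized inverse is a genuine infimum and
    not a default value. *)
Lemma superlevel_nonempty s : [set x | 0 < x /\ s < phi x] !=set0.
Proof.
have : \forall x \near +oo, 0 < x /\ s < phi x.
  near=> x; split => //.
  by near: x; have /cvgryPgt := phi_infty; exact.
move=> [a [_ aP]]; exists (a + 1); apply: aP.
by rewrite ltrDl.
Unshelve. all: by end_near. Qed.

Lemma generalized_inverse_ge s b :
  (forall x, 0 < x -> s < phi x -> b <= x) -> b <= generalized_inverse phi s.
Proof.
move=> sb; apply: lb_le_inf; first exact: superlevel_nonempty.
by move=> x [x0 sx]; exact: sb.
Qed.

Lemma generalized_inverse_ge0 s : 0 <= generalized_inverse phi s.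
Proof. by apply: generalized_inverse_ge => x x0 _; exact: ltW. Qed.

Lemma generalized_inverse_le s r : 0 < r -> s < phi r ->
  generalized_inverse phi s <= r.
Proof.
by move=> r0 sr; apply: ge_inf => //; exists 0 => x [/ltW].
Qed.

(** A zero denominator, as on the diagonal, is inverted to +oo, so positivity extends to r = 0; the
    potential must be positive at the pole too. *)
Lemma hke_gt0 s r : 0 < s -> 0 <= r -> (0 < hke s r)%E.
Proof.
move=> s0 r0; rewrite /heat_kernel_estimate lt_min; apply/andP; split.
  rewrite inver; case: eqVneq => // V0; rewrite lte_fin invr_gt0.
  by rewrite lt_neqAle eq_sym V0 V_ge0// generalized_inverse_ge0.
apply: mule_gt0 => //; rewrite inver; case: eqVneq => // V0.
rewrite lte_fin invr_gt0 lt_neqAle eq_sym V0 mulr_ge0 ?V_ge0 ?phi_ge0//.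
Qed.

Lemma hke_le_offdiag s r : 0 < r -> (hke s r <= (s / (V r * phi r))%:E)%E.
Proof.
move=> r0; rewrite /heat_kernel_estimate ge_min; apply/orP; right.
by rewrite inver gt_eqF ?mulr_gt0 ?V_gt0 ?phi_gt0.
Qed.

(** For s < phi(r) the generalized inverse is at most r, so the first term of the minimum is at
    least 1/V(r). *)
Lemma hke_ge s r a : 0 < r -> s < phi r -> a <= (V r)^-1 ->
  a <= s / (V r * phi r) -> (a%:E <= hke s r)%E.
Proof.
move=> r0 sr aV as_; rewrite /heat_kernel_estimate le_min; apply/andP; split.
  rewrite inver; case: eqVneq => [|V0]; first by rewrite leey.
  rewrite lee_fin (le_trans aV)// lef_pV2 ?posrE ?(V_gt0 r0)//.
    by apply: V_le; [exact: generalized_inverse_ge0|exact: generalized_inverse_le].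
  by rewrite lt_neqAle eq_sym V0 V_ge0// generalized_inverse_ge0.
by rewrite inver gt_eqF ?mulr_gt0 ?V_gt0 ?phi_gt0.
Qed.

(** The upper scaling of phi gives phi^-1(s) >= lam r with lam^alpha >= s/(cphi phi(r)); the lower
    scaling of V then gives V(phi^-1(s)) >= CV lam^A V(r). *)
Lemma hke_le_tail s r : 0 < r -> phi r <= s ->
  (hke s r <= (CV^-1 * cphi `^ (A / alpha) * (phi r / s) `^ (A / alpha) / V r)%:E)%E.
Proof.
move=> r0 rs; have p0 := phi_gt0 r0; have v0 := V_gt0 r0.
have s0 : 0 < s by exact: lt_le_trans rs.
have [/andP[CV0 _] Vscal] := V_wlsc; have [c1 phiscal] := phi_wusc.
have c0 : 0 < cphi by exact: lt_le_trans c1.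
have A0 : 0 < A by exact: lt_trans alpha_lt_A.
have al0 : alpha != 0 by rewrite gt_eqF.
pose X := s / (cphi * phi r).
have X0 : 0 < X by rewrite divr_gt0// mulr_gt0.
(* The scaling conditions need a factor at least 1, whereas [X] may fall below 1 because of
   [cphi]. *)
pose lam := Num.max 1 (X `^ alpha^-1).
have lam1 : 1 <= lam by rewrite le_max lexx.
have lam0 : 0 < lam by exact: lt_le_trans lam1.
have ge_inv : lam * r <= generalized_inverse phi s.
  apply: generalized_inverse_ge => x x0 sx.
  have rx : r <= x.
    rewrite leNgt; apply/negP => xr.
    by move: sx; rewrite ltNge (le_trans _ rs)// phi_le// ltW.
  have xr1 : 1 <= x / r by rewrite ler_pdivlMr// mul1r.
  rewrite -ler_pdivlMr// /lam ge_max xr1/=.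
  have := phiscal _ _ xr1 r0; rewrite divfK ?gt_eqF// => xle.
  have -> : x / r = ((x / r) `^ alpha) `^ alpha^-1.
    by rewrite -powRrM divff// powRr1// (le_trans _ xr1).
  rewrite ge0_ler_powR ?nnegrE ?invr_ge0 ?(ltW alpha_gt0) ?powR_ge0 ?(ltW X0)//.
  rewrite ler_pdivrMr ?mulr_gt0// mulrCA mulrA.
  by rewrite (le_trans (ltW sx)).
have Vge : CV * X `^ (A / alpha) * V r <= V (generalized_inverse phi s).
  apply: (@le_trans _ _ (V (lam * r))); last first.
    by apply: V_le => //; rewrite mulr_ge0// ltW.
  apply: le_trans (Vscal _ _ lam1 r0); rewrite ler_wpM2r ?(ltW v0)//.
  rewrite ler_wpM2l ?(ltW CV0)// mulrC powRrM.
  rewrite ge0_ler_powR ?nnegrE ?(ltW A0) ?powR_ge0 ?(ltW lam0)//.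
  by rewrite le_max lexx orbT.
have Y0 : 0 < CV * X `^ (A / alpha) * V r by rewrite !mulr_gt0// powR_gt0.
have Vi0 := lt_le_trans Y0 Vge.
rewrite /heat_kernel_estimate ge_min; apply/orP; left.
rewrite inver gt_eqF// lee_fin.
have -> : CV^-1 * cphi `^ (A / alpha) * (phi r / s) `^ (A / alpha) / V r =
    (CV * X `^ (A / alpha) * V r)^-1.
  rewrite -[CV^-1 * _ * _]mulrA -powRM ?(ltW c0) ?divr_ge0 ?(ltW p0) ?(ltW s0)//.
  have -> : cphi * (phi r / s) = X^-1 by rewrite invf_div mulrA.
  rewrite [RHS]invfM [X in _ = X * _]invfM; congr (_ * _ / _).
  by rewrite -(powR_inv1 (ltW X0)) -powRrM mulN1r powRN.
by rewrite lef_pV2 ?posrE.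
Qed.

(** * The kernel series at a fixed distance r > 0 from the pole *)

Section series.
Variables (c r t : R) (q : nat -> \bar R).
Hypotheses (c0 : 0 < c) (r0 : 0 < r) (t0 : 0 < t).
Hypothesis q_hke : forall k,
  ((c^-1)%:E * hke (k.+1%:R * t) r <= q k <= c%:E * hke (k.+1%:R * t) r)%E.

(** Any exponent strictly between 0 and A/alpha - 1 would serve: positivity keeps k^e - (k-1)^e of
    order k^(e-1), and the upper limit makes k^e k^(-A/alpha) summable. This is the midpoint. *)
Definition weight_exponent : R := (A / alpha - 1) / 2.
Local Notation e := weight_exponent.

Lemma weight_exponent_gt0 : 0 < e.
Proof. by rewrite divr_gt0// subr_gt0 ltr_pdivlMr// mul1r. Qed.

Let e0 := weight_exponent_gt0.
Let eE : 1 + 2 * e = A / alpha.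
Proof. by rewrite mulrC divfK// addrC subrK. Qed.

Definition tail_constant : R := c * (CV^-1 * cphi `^ (A / alpha)).
Local Notation B := tail_constant.

Lemma tail_constant_gt0 : 0 < B.
Proof.
have [/andP[CV0 _] _] := V_wlsc; have [c1 _] := phi_wusc.
by rewrite !mulr_gt0// ?invr_gt0// powR_gt0// (lt_le_trans _ c1).
Qed.

Let B0 := tail_constant_gt0.

Let st0 k : 0 < k.+1%:R * t. Proof. by rewrite mulr_gt0. Qed.

Let q0 k : (0 <= q k)%E.
Proof.
have /andP[+ _] := q_hke k; apply: le_trans; apply: mule_ge0.
  by rewrite lee_fin invr_ge0 ltW.
by rewrite ltW// hke_gt0// ltW.
Qed.

Let q_tail k : phi r <= k.+1%:R * t ->
  (q k <= (B * (V r)^-1 * (phi r / (k.+1%:R * t)) `^ (1 + 2 * e))%:E)%E.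
Proof.
move=> ps; have /andP[_ +] := q_hke k; move/le_trans; apply.
apply: (le_trans (lee_wpmul2l _ (hke_le_tail r0 ps))); first by rewrite lee_fin ltW.
by rewrite -EFinM lee_fin eE /B le_eqVlt; apply/orP; left; apply/eqP; ring.
Qed.

(** The constant of [weighted_series_compare] with C1 = c, C2 = B 2^(A/alpha) and c3 = 1/(4c), free
    of r and t. The power of 2 comes from phi(r) <= 2 K t, and the 4 from this together with K <=
    2(k+1). *)
Definition hardy_constant : R :=
  c^-1 / 4 * (1 - 2^-1 `^ e) / (c + B * 2 `^ (A / alpha) / e).

Lemma hardy_constant_gt0 : 0 < hardy_constant.
Proof.
rewrite divr_gt0 ?mulr_gt0 ?invr_gt0//.
  rewrite subr_gt0 -[ltRHS](congr1 (@^~ e) (powR1 R)) gt0_ltr_powR ?nnegrE ?invr_ge0//.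
  by rewrite invf_lt1// ltr1n.
by rewrite addr_gt0// divr_gt0// mulr_gt0// powR_gt0.
Qed.

Section large_time_scale.
Hypothesis t_lt : t < phi r.

Let p0 := phi_gt0 r0.
Let v0 : 0 < (V r)^-1. Proof. by rewrite invr_gt0 V_gt0. Qed.

Lemma time_steps : exists K : nat, [/\ (0 < K)%N, K%:R * t < phi r &
  phi r <= K.+1%:R * t].
Proof.
have ex : exists n : nat, phi r <= n%:R * t.
  exists (Num.truncn (phi r / t)).+1.
  by rewrite -ler_pdivrMr// ltW// truncnS_gt.
(* n = 0 is excluded by phi(r) > 0 and n = 1 by t < phi(r); the cut is the predecessor of the least
   n. *)
case: (ex_minnP ex) => -[|[|K]] phiK minK.
- by move: phiK; rewrite mul0r leNgt p0.
- by move: phiK; rewrite mul1r leNgt t_lt.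
exists K.+1; split => //; rewrite ltNge; apply/negP => /minK.
by rewrite ltnn.
Qed.

Section steps.
Variable K : nat.
Hypotheses (K0 : (0 < K)%N) (Kt : K%:R * t < phi r) (tK : phi r <= K.+1%:R * t).

Let phi2K : phi r <= 2 * K%:R * t.
Proof.
apply: (le_trans tK); rewrite ler_wpM2r ?(ltW t0)// -natr1.
have K1 : 1 <= K%:R :> R by rewrite ler1n.
lra.
Qed.

Lemma q_small k : (k < K)%N -> (q k <= (c * (V r)^-1)%:E)%E.
Proof.
move=> kK; have /andP[_ +] := q_hke k; move/le_trans; apply.
rewrite EFinM lee_wpmul2l ?lee_fin ?(ltW c0)//.
apply: (le_trans (hke_le_offdiag _ r0)); rewrite lee_fin invfM mulrCA ger_pMr//.
rewrite ler_pdivrMr// mul1r (le_trans _ (ltW Kt))// ler_wpM2r ?(ltW t0)//.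
by rewrite ler_nat.
Qed.

Lemma q_large k : (K <= k)%N ->
  (q k <= (B * 2 `^ (A / alpha) * (V r)^-1 *
     (K%:R / k.+1%:R) `^ (1 + 2 * e))%:E)%E.
Proof.
move=> Kk; apply: (le_trans (q_tail _)).
  by rewrite (le_trans tK)// ler_wpM2r ?(ltW t0)// ler_nat.
have E0 : 0 <= A / alpha by rewrite -eE; move: e0; lra.
rewrite lee_fin eE [X in _ <= X * _]mulrAC -[leRHS]mulrA.
apply: ler_wpM2l; first by apply: mulr_ge0; exact: ltW.
rewrite -powRM ?divr_ge0//.
apply: ge0_ler_powR => //; rewrite ?nnegrE.
- by rewrite divr_ge0 ?(ltW p0)// ltW.
- by rewrite mulr_ge0 ?divr_ge0.
rewrite ler_pdivrMr ?st0//.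
have -> : 2 * (K%:R / k.+1%:R) * (k.+1%:R * t) = 2 * K%:R * t.
  by field; rewrite addrC natr1 pnatr_eq0.
exact: phi2K.
Qed.

Lemma q_middle k : (k < K)%N -> (K <= k.+1 * 2)%N ->
  ((c^-1 / 4 * (V r)^-1)%:E <= q k)%E.
Proof.
move=> kK Kk; have /andP[+ _] := q_hke k; apply: le_trans.
rewrite -mulrA EFinM lee_wpmul2l ?lee_fin ?invr_ge0 ?(ltW c0)//.
have ktK : k.+1%:R * t <= K%:R * t by rewrite ler_wpM2r ?(ltW t0)// ler_nat.
apply: hke_ge => //.
- exact: le_lt_trans Kt.
- by rewrite ler_piMl ?(ltW v0)// invf_le1// ler1n.
rewrite invfM mulrCA mulrC ler_wpM2l ?(ltW v0)//.
rewrite ler_pdivlMr// ler_pdivrMl//.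
apply: (le_trans phi2K).
have : K%:R <= k.+1%:R * 2 :> R by rewrite -natrM ler_nat.
move=> /(ler_wpM2r (ltW t0)); lra.
Qed.

End steps.

Lemma series_compare :
  ((hardy_constant * t / phi r)%:E *
   \sum_(0 <= k <oo) ((k.+1%:R `^ e)%:E * q k) <=
   \sum_(0 <= k <oo) ((k.+1%:R `^ e - k%:R `^ e)%:E * q k))%E.
Proof.
have [K [K0 Kt tK]] := time_steps.
have C2 : 0 < B * 2 `^ (A / alpha) by rewrite mulr_gt0// powR_gt0.
have c3 : 0 < c^-1 / 4 by rewrite divr_gt0// invr_gt0.
have := weighted_series_compare e0 c0 C2 c3 v0 K0 q0
  (q_small Kt) (q_large K0 tK) (q_middle K0 Kt tK).
apply: le_trans; rewrite lee_wpmul2r//.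
  by apply: nneseries_ge0 => k _ _; rewrite mule_ge0// lee_fin powR_ge0.
(* K t < phi(r) turns the factor 1/K into t/phi(r). *)
rewrite lee_fin -/hardy_constant -mulrA ler_wpM2l ?(ltW hardy_constant_gt0)//.
by rewrite ler_pdivrMr// ler_pdivlMl ?ltr0n// ltW.
Qed.

End large_time_scale.

(** Finiteness is required also where phi(r) <= t, because the ground state argument runs over the
    whole space off the pole. *)
Lemma series_fin : (\sum_(0 <= k <oo) ((k.+1%:R `^ e)%:E * q k) < +oo)%E.
Proof.
have p0 := phi_gt0 r0.
have v0 : 0 < (V r)^-1 by rewrite invr_gt0 V_gt0.
have [tp|pt] := ltP t (phi r).
  have [K [K0 Kt tK]] := time_steps tp.
  have C2 : 0 < B * 2 `^ (A / alpha) by rewrite mulr_gt0// powR_gt0.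
  have := weighted_series_le e0 C2 v0 K0 q0 (q_small Kt) (q_large K0 tK).
  by move=> /le_lt_trans; apply; rewrite ltry.
(* For t >= phi r all terms are in the tail regime: take K = 1. *)
pose M := B * (V r)^-1 * (phi r / t) `^ (1 + 2 * e).
have M0 : 0 < M.
  apply: mulr_gt0; first exact: mulr_gt0.
  by apply: powR_gt0; exact: divr_gt0.
have qM k : (q k <= (M * 1 * (1%:R / k.+1%:R) `^ (1 + 2 * e))%:E)%E.
  apply: (le_trans (q_tail _)).
    by rewrite (le_trans pt)// ler_peMl ?(ltW t0)// ler1n.
  rewrite /M mulr1 lee_fin -[leRHS]mulrA -powRM ?divr_ge0 ?(ltW p0) ?(ltW t0)//.
  rewrite le_eqVlt; apply/orP; left; apply/eqP.
  by congr (_ * _ `^ _); rewrite invfM mul1r -mulrA (mulrC t^-1).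
have qS k : (k < 1)%N -> (q k <= (M * 1)%:E)%E.
  case: k => // _; apply: le_trans (qM 0%N) _.
  by rewrite divr1 powR1 mulr1.
have := weighted_series_le e0 M0 ltr01 (ltnSn 0) q0 qS (fun k _ => qM k).
by move=> /le_lt_trans; apply; rewrite ltry.
Qed.

End series.
End kernel_estimates.

(** * The Hardy inequality *)

Section borel_metric.
Context {R : realType} {F : pmetricType R}.

Lemma borel_open (U : set F) : open U -> measurable (U : set (borel F)).
Proof. by move=> oU; exact: sub_sigma_algebra. Qed.

Lemma open_mdist_gt (y : F) (a : R) : open [set x : F | a < mdist x y].
Proof.
rewrite openE => x /= ax; apply/nbhs_ballP.
exists (mdist x y - a) => /=; first by rewrite subr_gt0.
move=> z; rewrite ballEmdist/= => xz.
have := metric_triangle x z y; lra.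
Qed.

Lemma measurable_mdist (y : F) :
  measurable_fun [set: borel F] (fun x : borel F => mdist (x : F) y : R).
Proof.
apply: (measurability _ (RGenOInfty.measurableE R)).
move=> _ [_ [a ->] <-]; rewrite setTI.
have -> : (fun x : borel F => mdist (x : F) y) @^-1` `]a, +oo[ =
    [set x : F | a < mdist x y].
  by apply/seteqP; split => x /=; rewrite in_itv/= andbT.
exact: borel_open (open_mdist_gt y a).
Qed.

Lemma measurable_point (y : F) : measurable ([set y] : set (borel F)).
Proof.
rewrite -[X in measurable X]setCK; apply: measurableC.
have -> : ~` [set y] = [set x : F | 0 < mdist x y].
  by apply/seteqP; split => x /=; rewrite mdist_gt0 => /eqP.
exact: borel_open (open_mdist_gt y 0).
Qed.

Lemma measurable_scale_mdist (phi : R -> R) (y : F) : scale_function phi ->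
  measurable_fun [set: borel F] (fun x : borel F => phi (mdist (x : F) y)).
Proof.
move=> [_ _ phi_le].
(* [phi] is unconstrained at negative arguments; cutting at 0 gives a function monotone on the whole
   line, hence Borel. *)
rewrite (_ : (fun x => _) = (fun r => phi (Num.max 0 r)) \o
    (fun x : borel F => mdist (x : F) y)); last first.
  by apply/funext => x /=; rewrite max_r// mdist_ge0.
apply: measurableT_comp; last exact: measurable_mdist.
apply: nondecreasing_measurable => // r s rs.
apply: phi_le; first by rewrite le_max lexx.
by rewrite ge_max !le_max lexx rs orbT.
Qed.

(** Lower scaling with factor 1/r gives V(r) <= V(1) r^A/CV for r <= 1, so the balls about y have
    measure tending to 0. The pole thus becomes the exceptional null set. *)
Lemma measure_point0 (m : {measure set (borel F) -> \bar R}) (V : R -> R)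
    (A CV c2 : R) (y : F) :
  0 < A -> wlsc A CV V -> 0 < c2 ->
  (forall r, 0 <= r -> (m (ball y r) <= (c2 * V r)%:E)%E) ->
  m [set y] = 0%E.
Proof.
move=> A0 [/andP[CV0 _] Vscal] c20 mb.
have my := measurable_point y.
have yb r : 0 < r -> (m [set y] <= (c2 * V r)%:E)%E.
  move=> r0; apply: le_trans (mb _ (ltW r0)).
  apply: le_measure; rewrite ?inE//.
    rewrite ballEmdist; have -> : [set x | mdist y x < r] = ~` [set x : F | r <= mdist x y].
      by apply/seteqP; split => x /=; rewrite metric_sym ltNge => /negP.
    apply: measurableC.
    have -> : [set x : F | r <= mdist x y] =
        (fun x : borel F => mdist (x : F) y) @^-1` `[r, +oo[.
      by apply/seteqP; split => x /=; rewrite in_itv/= andbT.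
    by rewrite -[X in measurable X]setTI; apply: measurable_mdist.
  by move=> x ->; apply: ballxx.
have V1 r : 0 < r -> r <= 1 -> V r <= CV^-1 * V 1 * r `^ A.
  move=> r0 r1; have := Vscal r^-1 r; rewrite mulVf ?gt_eqF// invf_ge1// => /(_ r1 r0).
  rewrite -(powR_inv1 (ltW r0)) -powRrM mulN1r powRN => VV.
  by rewrite -ler_pdivrMr ?powR_gt0// ler_pdivlMl// mulrA mulrAC.
apply/eqP; rewrite eq_le measure_ge0 andbT.
pose B := c2 * (CV^-1 * V 1).
apply/lee_addgt0Pr => eps eps0; rewrite add0e.
pose M := Num.max B 1.
have M0 : 0 < M by rewrite lt_max ltr01 orbT.
pose r := Num.min 1 ((eps / M) `^ A^-1).
have r0 : 0 < r by rewrite lt_min ltr01 powR_gt0// divr_gt0.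
have r1 : r <= 1 by rewrite ge_min lexx.
have rA : r `^ A <= eps / M.
  have -> : eps / M = ((eps / M) `^ A^-1) `^ A.
    by rewrite -powRrM mulVf ?gt_eqF// powRr1// divr_ge0// ltW.
  rewrite ge0_ler_powR ?nnegrE ?powR_ge0 ?(ltW A0) ?(ltW r0)//.
  by rewrite ge_min lexx orbT.
apply: (le_trans (yb _ r0)); rewrite lee_fin.
apply: (@le_trans _ _ (B * r `^ A)).
  by rewrite /B -[leRHS]mulrA ler_wpM2l ?(ltW c20)// V1.
apply: (@le_trans _ _ (M * r `^ A)).
  by rewrite ler_wpM2r ?powR_ge0// le_max lexx.
apply: (le_trans (ler_wpM2l (ltW M0) rA)).
by rewrite mulrC divfK// gt_eqF.
Qed.

End borel_metric.

(** * Fixed pole: the truncated inequality and its monotone limit *)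

Section hardy.
Context {R : realType} {F : pmetricType R}.
Variables (m : {sigma_finite_measure set (borel F) -> \bar R}).
Variables (phi V : R -> R) (p : R -> borel F -> borel F -> \bar R).
Variables (c A alpha CV cphi : R).
Hypothesis phi_scale : scale_function phi.
Hypothesis V_scale : scale_function V.
Hypothesis phi_infty : phi s @[s --> +oo] --> +oo.
Hypothesis m_point : forall y : F, m [set y] = 0%E.
Hypothesis p_td : transition_density m p.
Hypothesis c0 : 0 < c.
Hypothesis p_hke : forall (t : R) (x y : F), 0 < t ->
  ((c^-1)%:E * heat_kernel_estimate phi V t (mdist x y) <= p t x y <=
   c%:E * heat_kernel_estimate phi V t (mdist x y))%E.
Hypothesis alpha_gt0 : 0 < alpha.
Hypothesis alpha_lt_A : alpha < A.
Hypothesis V_wlsc : wlsc A CV V.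
Hypothesis phi_wusc : wusc alpha cphi phi.

Local Notation kappa := (hardy_constant A alpha CV cphi c).
Local Notation e := (weight_exponent A alpha).

Let e0 : 0 < e. Proof. exact: weight_exponent_gt0. Qed.

Let phi_gt0 r : 0 < r -> 0 < phi r. Proof. by case: phi_scale => _ + _; exact. Qed.
Let phi0 : phi 0 = 0. Proof. by case: phi_scale. Qed.

Variables (y : F) (u : borel F -> R).
Hypothesis mu : measurable_fun [set: borel F] u.
Hypothesis u2 : m.-integrable [set: borel F] (fun x => (u x ^+ 2)%:E).

Let S (t : R) : set (borel F) := [set x | t < phi (mdist (x : F) y)].

Let mS t : measurable (S t).
Proof.
have -> : S t = [set: borel F] `&`
    (fun x : borel F => phi (mdist (x : F) y)) @^-1` `]t, +oo[.
  by rewrite setTI; apply/seteqP; split => x /=; rewrite in_itv/= andbT.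
exact: measurable_scale_mdist.
Qed.

Let S_neq t x : 0 < t -> S t x -> 0 < mdist (x : F) y.
Proof.
move=> t0; rewrite /S/= mdist_gt0 => tx; apply/negP => /eqP xy.
by move: tx; rewrite xy mdistxx phi0 ltNge (ltW t0).
Qed.

Let phi_ge0 (x : F) : 0 <= phi (mdist x y).
Proof.
have [p0 _ phi_le] := phi_scale.
by have := phi_le _ _ (lexx 0) (mdist_ge0 x y); rewrite p0.
Qed.

Let w (x : borel F) : R := u x ^+ 2 * (kappa / phi (mdist (x : F) y)).

Let mw : measurable_fun [set: borel F] (fun x => (w x)%:E).
Proof.
apply/measurable_EFinP; apply: measurable_funM; first exact: measurable_funX.
rewrite (_ : (fun x => _) = (fun x : borel F =>
    kappa * (phi (mdist (x : F) y)) `^ (-1))); last first.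
  by apply/funext => x; rewrite powR_inv1.
apply: measurable_funM; first exact: measurable_cst.
exact: (measurableT_comp (measurable_powR (-1)) (measurable_scale_mdist y phi_scale)).
Qed.

Let kappa_gt0 : 0 < kappa.
Proof. exact: (hardy_constant_gt0 alpha_gt0 alpha_lt_A V_wlsc phi_wusc c0). Qed.

Let w0 x : 0 <= w x.
Proof. by rewrite mulr_ge0 ?sqr_ge0// divr_ge0// ltW. Qed.

(** The ground state inequality with exceptional set {y} and minorant kappa t/phi(rho); dividing by
    t cancels the time, leaving a weight independent of t. *)
Lemma truncated_hardy (t : R) : 0 < t ->
  (\int[m]_(x in S t) (w x)%:E <= dirichlet_form m p u)%E.
Proof.
move=> t0.
apply: le_trans (energy_quotient_le_dirichlet p_td u2 mu t0).
have q_hke (x : F) k : ((c^-1)%:E * heat_kernel_estimate phi V (k.+1%:R * t) (mdist x y)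
    <= p (k.+1%:R * t) x y <=
    c%:E * heat_kernel_estimate phi V (k.+1%:R * t) (mdist x y))%E.
  by apply: p_hke; rewrite mulr_gt0.
have h0 x : (0 < potential p t e y x)%E.
  apply: lt_le_trans (potential_ge p_td e y t0 x).
  have /andP[+ _] := p_hke x y t0; apply: lt_le_trans.
  rewrite mule_gt0 ?lte_fin ?invr_gt0//.
  exact: (hke_gt0 phi_scale V_scale phi_infty t0 (mdist_ge0 _ _)).
have hfin (x : borel F) : ~ [set y] x -> (potential p t e y x < +oo)%E.
  move=> xy; have r0 : 0 < mdist (x : F) y by rewrite mdist_gt0; exact/eqP.
  exact: (series_fin phi_scale V_scale phi_infty alpha_gt0 alpha_lt_A
    V_wlsc phi_wusc c0 r0 t0 (q_hke x)).
have SN x : S t x -> ~ [set y] x.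
  by move=> /(S_neq t0) + xy; rewrite xy mdistxx ltxx.
have := @ground_state_energy _ _ _ m p p_td u u2 mu t (potential p t e y)
  (potential_drop p t e y) [set y] t0
  (measurable_potential p_td e y t0) h0
  (measurable_potential_drop p_td y t0 e0) (potential_drop_ge0 p_td y t0 e0)
  (heat_potential p_td y t0 e0) (measurable_point y) (m_point y) hfin
  (S t) (fun x => kappa * t / phi (mdist (x : F) y)) (mS t) SN.
have mr : measurable_fun (S t) (fun x : borel F => kappa * t / phi (mdist (x : F) y)).
  apply: (@measurable_funS _ _ _ _ [set: borel F]) => //.
  rewrite (_ : (fun x => _) = (fun x : borel F =>
      kappa * t * (phi (mdist (x : F) y)) `^ (-1))); last first.
    by apply/funext => x; rewrite powR_inv1.
  apply: measurable_funM; first exact: measurable_cst.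
  exact: (measurableT_comp (measurable_powR (-1)) (measurable_scale_mdist y phi_scale)).
move=> /(_ mr) H.
rewrite [_ / t]mulrC [(t^-1 * _)%:E]EFinM lee_pdivlMl//.
apply: le_trans (H _ _); last 2 first.
- by move=> x _; rewrite divr_ge0// mulr_ge0// ltW.
- move=> x Sx.
  exact: (series_compare phi_scale V_scale phi_infty alpha_gt0 alpha_lt_A
    V_wlsc phi_wusc c0 (S_neq t0 Sx) t0 (q_hke x) Sx).
rewrite -ge0_integralZl//.
- rewrite le_eqVlt; apply/orP; left; apply/eqP; apply: eq_integral => x _.
  by rewrite -EFinM /w; congr EFin; ring.
- exact: measurable_funS mw.
- by move=> x _; rewrite lee_fin.
- by rewrite lee_fin ltW.
Qed.

(** Since phi > 0 off the diagonal, the sets S(1/(n+1)) increase to the complement of the null set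
    {y}, and monotone convergence removes the truncation. *)
Lemma sigma_finite_hardy :
  (kappa%:E * (\int[m]_x ((u x ^+ 2)%:E / (phi (mdist (x : F) y))%:E))
    <= dirichlet_form m p u)%E.
Proof.
pose G (x : borel F) : \bar R := ((u x ^+ 2)%:E / (phi (mdist (x : F) y))%:E)%E.
have my := measurable_point y.
have mCy : measurable (~` [set y] : set (borel F)) by exact: measurableC.
have GE (x : borel F) : ~ [set y] x -> (kappa%:E * G x = (w x)%:E)%E.
  move=> xy; have r0 : 0 < mdist (x : F) y by rewrite mdist_gt0; exact/eqP.
  by rewrite /G inver gt_eqF ?phi_gt0// -!EFinM /w mulrCA.
have G0 x : (0 <= G x)%E.
  by rewrite /G mule_ge0 ?lee_fin ?sqr_ge0// inve_ge0 lee_fin.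
have mGC : measurable_fun (~` [set y] : set (borel F)) (fun x => kappa%:E * G x)%E.
  apply: (@eq_measurable_fun _ _ _ _ _ (fun x => (w x)%:E)).
    by move=> x; rewrite inE => xy; rewrite GE.
  exact: measurable_funS mw.
(* The weight is +oo at y, where it differs from the real-valued [w]; measurability is glued from
   the point and its complement. *)
have mG : measurable_fun [set: borel F] (fun x => kappa%:E * G x)%E.
  rewrite -(setUv ([set y] : set (borel F))); apply/measurable_funU => //; split => //.
  apply: (@eq_measurable_fun _ _ _ _ _ (cst (kappa%:E * G y)%E)).
    by move=> x; rewrite inE => ->.
  exact: measurable_cst.
have mG1 : measurable_fun [set: borel F] G.
  rewrite (_ : G = (fun x => (kappa^-1)%:E * (kappa%:E * G x))%E).
    exact: emeasurable_funM.
  by apply/funext => x; rewrite muleA -EFinM mulVf ?gt_eqF// mul1e.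
have k0 : (0 <= kappa%:E)%E by rewrite lee_fin ltW.
have -> := esym (ge0_integralZl m measurableT mG1 (fun x _ => G0 x) k0).
have kG0 x : [set: borel F] x -> (0 <= kappa%:E * G x)%E.
  by move=> _; rewrite mule_ge0// lee_fin ltW.
rewrite (ge0_negligible_integral my measurableT mG kG0 (m_point y)).
have n0 (n : nat) : 0 < n.+1%:R^-1 :> R by rewrite invr_gt0.
have -> : [set: borel F] `\` [set y] = \bigcup_n S n.+1%:R^-1.
  apply/seteqP; split => x /=.
    move=> [_ xy]; have r0 : 0 < mdist (x : F) y by rewrite mdist_gt0; exact/eqP.
    have := phi_gt0 r0; set b := phi _ => b0.
    exists (Num.truncn b^-1) => //=; rewrite /S/= -/b.
    by rewrite invf_plt ?posrE// truncnS_gt.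
  move=> [n _] /= Sx; split => // xy.
  by have := S_neq (n0 n) Sx; rewrite xy mdistxx ltxx.
have Sneq n x : S n.+1%:R^-1 x -> ~ [set y] x.
  by move=> /(S_neq (n0 n)) + xy; rewrite xy mdistxx ltxx.
have SH : {homo (fun n : nat => S n.+1%:R^-1) : n k / (n <= k)%N >-> (n <= k)%O}.
  move=> n k nk; apply/subsetPset => x; apply: le_lt_trans.
  by rewrite lef_pV2 ?posrE// ler_nat.
have cvg := @ge0_nondecreasing_set_cvg_integral _ _ _ _ (fun x => kappa%:E * G x)%E
  m SH (fun n => mS _) (fun n => measurable_funS measurableT (@subsetT _ _) mG)
  (fun n x _ => kG0 x I).
rewrite -(cvg_lim _ cvg)//; apply: lime_le.
  by apply/cvg_ex; eexists; exact: cvg.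
apply: nearW => n.
rewrite (eq_integral (fun x => (w x)%:E)).
  by apply: truncated_hardy; rewrite invr_gt0.
by move=> x; rewrite inE => /Sneq xy; rewrite GE.
Qed.

End hardy.

Section sigma_finite_copy.
Context d (T : measurableType d) (R : realType) (m : {measure set T -> \bar R}).
Hypothesis mT : sigma_finite [set: T] m.

Definition sigma_finite_copy of sigma_finite [set: T] m : set T -> \bar R := m.

HB.instance Definition _ := Measure.copy (sigma_finite_copy mT) m.
HB.instance Definition _ :=
  Measure_isSigmaFinite.Build _ _ _ (sigma_finite_copy mT) mT.

End sigma_finite_copy.

Unset Implicit Arguments.
Set Strict Implicit.

Theorem theorem10 (R : realType) (F : pmetricType R)
  (m : {measure set (borel F) -> \bar R})
  (phi V : R -> R) (p : R -> borel F -> borel F -> \bar R)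
  (c1 c2 A alpha CV cphi : R)
  (m_radon : radon m)
  (m_supp : full_support m)
  (m_sigma_finite : sigma_finite [set: borel F] m)
  (phi_scale : scale_function phi)
  (V_scale : scale_function V)
  (phi_left_cont : forall r, 0 < r -> phi s @[s --> r^'-] --> phi r)
  (phi_infty : phi s @[s --> +oo] --> +oo)
  (c1_gt0 : 0 < c1)
  (c2_gt0 : 0 < c2)
  (m_ball : forall (x : F) (r : R), 0 <= r ->
     ((c1 * V r)%:E <= m (ball x r) <= (c2 * V r)%:E)%E)
  (p_td : transition_density m p)
  (p_approx : approx_on [set z : R * F * F | 0 < z.1.1]
     (fun z => p z.1.1 z.1.2 z.2)
     (fun z => heat_kernel_estimate phi V z.1.1 (mdist z.1.2 z.2)))
  (alpha_gt0 : 0 < alpha)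
  (alpha_lt_A : alpha < A)
  (V_wlsc : wlsc A CV V)
  (phi_wusc : wusc alpha cphi phi) :
  exists2 C : R, 0 < C &
    forall (y : F) (u : borel F -> R), u \in Lfun m 2%:E ->
      (C%:E * (\int[m]_x ((u x ^+ 2)%:E / (phi (mdist (x : F) y))%:E))
         <= dirichlet_form m p u)%E.
Proof.
have [c c0 p_hke] := p_approx.
exists (hardy_constant A alpha CV cphi c).
  exact: (hardy_constant_gt0 alpha_gt0 alpha_lt_A V_wlsc phi_wusc c0).
move=> y u u_L2.
have mu : measurable_fun [set: borel F] u.
  by move: u_L2; rewrite inE => /andP[+ _]; rewrite inE.
have u2 := Lfun2_integrable_sqr u_L2.
pose m' : {sigma_finite_measure set (borel F) -> \bar R} :=
  sigma_finite_copy m_sigma_finite.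
have m_point (z : F) : m' [set z] = 0%E.
  apply: (measure_point0 (lt_trans alpha_gt0 alpha_lt_A) V_wlsc c2_gt0) => r r0.
  by have /andP[] := m_ball z r r0.
have p_td' : transition_density m' p.
  by case: p_td => mp p0 psym pCK p1; split.
exact: (@sigma_finite_hardy _ _ m' phi V p c A alpha CV cphi phi_scale V_scale
  phi_infty m_point p_td' c0 (fun t x z t0 => p_hke (t, x, z) t0)
  alpha_gt0 alpha_lt_A V_wlsc phi_wusc y u mu u2).
Qed.
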